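(* Let $P(\lambda)=\begin{bmatrix}-A(\lambda)&B(\lambda)\\ C(\lambda)&D(\lambda)\end{bmatrix}\in\mathbb{C}[\lambda]^{(n+p)\times(n+p)}$ be a regular polynomial system matrix, with $A(\lambda)\in\mathbb{C}[\lambda]^{n\times n}$ regular, $D(\lambda)\in\mathbb{C}[\lambda]^{p\times p}$, and transfer function matrix $R(\lambda)=D(\lambda)+C(\lambda)A(\lambda)^{-1}B(\lambda)$. Let $\lambda_0\in\mathbb{C}$ be a simple eigenvalue of $P(\lambda)$ with right eigenvector $v$, and assume that $P(\lambda)$ is minimal at $\lambda_0$. Let $\Delta P(\lambda)=\begin{bmatrix}-\Delta A(\lambda)&\Delta B(\lambda)\\ \Delta C(\lambda)&\Delta D(\lambda)\end{bmatrix}$ be a polynomial matrix partitioned conformably with $P(\lambda)$, let $R(\lambda)+\Delta R(\lambda,\epsilon)$ be the transfer function matrix of $P(\lambda)+\epsilon\Delta P(\lambda)$, that is, $$R(\lambda)+\Delta R(\lambda,\epsilon)=D(\lambda)+\epsilon\Delta D(\lambda)+(C(\lambda)+\epsilon\Delta C(\lambda))(A(\lambda)+\epsilon\Delta A(\lambda))^{-1}(B(\lambda)+\epsilon\Delta B(\lambda)),$$ and let $$\Delta R(\lambda):=\Delta D(\lambda)+\Delta C(\lambda)A(\lambda)^{-1}B(\lambda)+C(\lambda)A(\lambda)^{-1}\Delta B(\lambda)-C(\lambda)A(\lambda)^{-1}\Delta A(\lambda)A(\lambda)^{-1}B(\lambda).$$ For $\epsilon>0$ small enough, let $\lambda_0+\Delta\lambda_0$,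 with $\Delta\lambda_0=\Delta\lambda_0(\epsilon)$, be the eigenvalue of $P(\lambda)+\epsilon\Delta P(\lambda)$ arising from the perturbation of $\lambda_0$, i.e. satisfying $\Delta\lambda_0\to0$ as $\epsilon\to0$ and, for some $\Delta v$ with $v+\epsilon\Delta v\ne0$, $[P(\lambda_0+\Delta\lambda_0)+\epsilon\Delta P(\lambda_0+\Delta\lambda_0)][v+\epsilon\Delta v]=0$. Then, for $\epsilon>0$ small enough, $\lambda_0+\Delta\lambda_0$ is also a zero of $R(\lambda)+\Delta R(\lambda,\epsilon)$. In addition, there exist right and left root vectors $x(\lambda)\in\mathbb{C}(\lambda)^p$ and $y(\lambda)\in\mathbb{C}(\lambda)^p$ of $R(\lambda)$ associated with $\lambda_0$, respectively, such that $$|\Delta\lambda_0|=\epsilon\lim_{\lambda\to\lambda_0}\left|\frac{y(\lambda)^T\Delta R(\lambda)x(\lambda)}{y(\lambda)^TR'(\lambda)x(\lambda)}\right|+o(\epsilon).$$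
   Context: A square polynomial or rational matrix is regular if its determinant is not identically zero. $P(\lambda)$ is minimal at $\lambda_0$ if $\begin{bmatrix}-A(\lambda_0)\\C(\lambda_0)\end{bmatrix}$ has full column rank and $\begin{bmatrix}A(\lambda_0)&B(\lambda_0)\end{bmatrix}$ has full row rank. For every regular rational matrix $M(\lambda)\in\mathbb{C}(\lambda)^{q\times q}$ and $\mu\in\mathbb{C}$ there are rational matrices $G_1,G_2$ invertible at $\mu$ (no pole at $\mu$ and nonzero determinant there) with $G_1MG_2=\mathrm{diag}((\lambda-\mu)^{\nu_1},\dots,(\lambda-\mu)^{\nu_q})$, with uniquely determined integers $\nu_1\le\dots\le\nu_q$; $\mu$ is a zero (eigenvalue, for polynomial $M$) of $M$ if some $\nu_i>0$, and it is simple if exactly one $\nu_i$ is positive and it equals $1$. A right eigenvector of $P(\lambda)$ associated with $\lambda_0$ is a nonzero $v$ with $P(\lambda_0)v=0$. A right root vector of $R(\lambda)$ associated with $\lambda_0$ is a rational vector $x(\lambda)$ without pole at $\lambda_0$, with $x(\lambda_0)\ne0$ and $\lim_{\lambda\to\lambda_0}R(\lambda)x(\lambda)=0$; a left root vector is a rational vector $y(\lambda)$ without pole at $\lambda_0$, with $y(\lambda_0)\neq0$ and $\lim_{\lambda\to\lambda_0}y(\lambda)^TR(\lambda)=0$. $\lambda_0$ may be a pole of $R(\lambda)$. *)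

(* Defs.v *)
From HB Require Import structures.
From mathcomp Require Export all_boot all_order all_algebra.
From mathcomp Require Export all_classical all_reals all_analysis.
From mathcomp Require Export complex generic_quotient fraction.
From mathcomp Require Import ring.
Export numFieldNormedType.Exports.

Set Implicit Arguments.
Unset Strict Implicit.
Unset Printing Implicit Defensive.

Import Order.TTheory GRing.Theory Num.Theory.

Local Open Scope classical_set_scope.
Local Open Scope complex_scope.
Local Open Scope quotient_scope.
Local Open Scope ring_scope.

Notation "x %:F" := (@FracField.tofrac _ x) : ring_scope.

Section RationalFunctions.
Variable C : numFieldType.
Implicit Types (f : {fraction {poly C}}) (p q : {poly C}) (z : C).

(* The representative of [f] in the quotient is arbitrary; dividing out the gcd
   makes numerator and denominator coprime, so that they are determined by [f]
   up to a common nonzero scalar factor. *)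
Definition ratf_num f : {poly C} :=
  let r := generic_quotient.repr f in (frac r).1 %/ gcdp (frac r).1 (frac r).2.
Definition ratf_den f : {poly C} :=
  let r := generic_quotient.repr f in (frac r).2 %/ gcdp (frac r).1 (frac r).2.

Definition no_pole z f : Prop := (ratf_den f).[z] != 0.

(* Equal to 0, by the convention x / 0 = 0, when z is a pole of f. *)
Definition ratf_eval z f : C := (ratf_num f).[z] / (ratf_den f).[z].

Definition ratf_deriv f : {fraction {poly C}} :=
  ((ratf_num f)^`() * ratf_den f - ratf_num f * (ratf_den f)^`())%:F
   / (ratf_den f ^+ 2)%:F.

Lemma ratf_den_neq0 f : ratf_den f != 0.
Proof.
rewrite /ratf_den dvdp_div_eq0 ?dvdp_gcdr //; exact: denom_ratioP.
Qed.

Lemma coprime_ratf_num_den f : coprimep (ratf_num f) (ratf_den f).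
Proof. by apply: coprimep_div_gcd; rewrite denom_ratioP orbT. Qed.

Lemma ratf_num_div_den f : f = (ratf_num f)%:F / (ratf_den f)%:F.
Proof.
set r := generic_quotient.repr f.
have d0 : (frac r).2 != 0 := denom_ratioP _.
have g0 : gcdp (frac r).1 (frac r).2 != 0 by rewrite gcdp_eq0 (negbTE d0) andbF.
have fE : f * ((frac r).2)%:F = ((frac r).1)%:F.
  rewrite -[f]reprK -/r; unlock FracField.tofrac.
  rewrite -[LHS]FracField.pi_mul; apply/eqmodP => /=.
  rewrite equivfE /FracField.mulf !numden_Ratio ?(oner_neq0, mulf_neq0) //.
  by rewrite !mulr1 mulrC.
have [nE dE] : (frac r).1 = ratf_num f * gcdp (frac r).1 (frac r).2
            /\ (frac r).2 = ratf_den f * gcdp (frac r).1 (frac r).2.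
  by rewrite /ratf_num /ratf_den -/r /= !divpK ?dvdp_gcdl ?dvdp_gcdr.
have D0 : (ratf_den f)%:F != 0 by rewrite tofrac_eq0 ratf_den_neq0.
apply: (mulIf D0); rewrite divfK //.
have G0 : (gcdp (frac r).1 (frac r).2)%:F != 0 by rewrite tofrac_eq0.
by apply: (mulIf G0); rewrite -mulrA -!tofracM -dE -nE fE.
Qed.

Let cross p q f : q != 0 -> f = p%:F / q%:F ->
  p * ratf_den f = ratf_num f * q.
Proof.
move=> q0 fE; apply/eqP; rewrite -tofrac_eq !tofracM; apply/eqP.
have Q0 : q%:F != 0 by rewrite tofrac_eq0.
have D0 : (ratf_den f)%:F != 0 by rewrite tofrac_eq0 ratf_den_neq0.
apply/eqP; rewrite -(eqr_div _ _ Q0 D0) -fE -ratf_num_div_den; exact: eqxx.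
Qed.

Lemma ratf_evalE p q z : q.[z] != 0 ->
  no_pole z (p%:F / q%:F) /\ ratf_eval z (p%:F / q%:F) = p.[z] / q.[z].
Proof.
move=> qz0; set f := _ / _.
have q0 : q != 0 by apply: contraNneq qz0 => ->; rewrite horner0.
have E := cross q0 (erefl f).
have Dz : (ratf_den f).[z] != 0.
  have : ratf_den f %| q.
    have co : coprimep (ratf_den f) (ratf_num f).
      by rewrite coprimep_sym coprime_ratf_num_den.
    by rewrite -(Gauss_dvdpr q co) -E dvdp_mulIr.
  case/dvdpP => s qE; apply: contraNneq qz0 => Dz0.
  by rewrite qE hornerM Dz0 mulr0.
split=> //; apply/eqP; rewrite eq_sym /ratf_eval eqr_div //.
by rewrite -!hornerM E.
Qed.

Lemma ratf_derivE p q : q != 0 ->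
  ratf_deriv (p%:F / q%:F) = (p^`() * q - p * q^`())%:F / (q ^+ 2)%:F.
Proof.
move=> q0; set f := _ / _; have E := cross q0 (erefl f).
have D0 := ratf_den_neq0 f.
apply/eqP; rewrite /ratf_deriv eqr_div; first last.
- by rewrite tofrac_eq0 expf_neq0.
- by rewrite tofrac_eq0 expf_neq0.
rewrite -!tofracM tofrac_eq.
have E' : p^`() * ratf_den f =
    (ratf_num f)^`() * q + ratf_num f * q^`() - p * (ratf_den f)^`().
  by apply/eqP; rewrite -subr_eq opprK -!derivM E.
apply/eqP; transitivity (q * ratf_den f * (p^`() * ratf_den f)
    - q^`() * ratf_den f * (p * ratf_den f)); last by ring.
have -> : p^`() * ratf_den f =
    (ratf_num f)^`() * q + ratf_num f * q^`() - p * (ratf_den f)^`() := E'.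
transitivity (q * ratf_den f * ((ratf_num f)^`() * q + ratf_num f * q^`())
    - (q * (ratf_den f)^`() + q^`() * ratf_den f) * (p * ratf_den f));
  last by ring.
by rewrite E; ring.
Qed.

End RationalFunctions.

Section RationalMatrices.
Variable C : numFieldType.
Local Notation ratf := {fraction {poly C}}.

Definition regular (K : idomainType) q (M : 'M[K]_q) : Prop := \det M != 0.

Definition horner_mx_at m n (z : C) (M : 'M[{poly C}]_(m, n)) : 'M[C]_(m, n) :=
  map_mx (horner_eval z) M.

Definition ratmx_eval m n (z : C) (M : 'M[ratf]_(m, n)) : 'M[C]_(m, n) :=
  map_mx (ratf_eval z) M.

Definition poly_ratmx m n (M : 'M[{poly C}]_(m, n)) : 'M[ratf]_(m, n) :=
  map_mx (@FracField.tofrac {poly C}) M.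

Definition ratmx_deriv m n (M : 'M[ratf]_(m, n)) : 'M[ratf]_(m, n) :=
  map_mx (@ratf_deriv C) M.

Definition ratmx_no_pole m n (z : C) (M : 'M[ratf]_(m, n)) : Prop :=
  forall i j, no_pole z (M i j).

Definition invertible_at q (z : C) (G : 'M[ratf]_q) : Prop :=
  ratmx_no_pole z G /\ \det (ratmx_eval z G) != 0.

(* nu is the (unique) list of structural indices of M at mu. *)
Definition local_smith q (mu : C) (M : 'M[ratf]_q) (nu : 'I_q -> int) : Prop :=
  (forall i j : 'I_q, (i <= j)%N -> nu i <= nu j) /\
  exists G1 G2 : 'M[ratf]_q,
    [/\ invertible_at mu G1, invertible_at mu G2 &
        G1 *m M *m G2 = diag_mx (\row_i (('X - mu%:P)%:F ^ nu i))].

Definition is_zero q (mu : C) (M : 'M[ratf]_q) : Prop :=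
  exists2 nu, local_smith mu M nu & exists i, 0 < nu i.

Definition is_simple_zero q (mu : C) (M : 'M[ratf]_q) : Prop :=
  exists2 nu, local_smith mu M nu &
    exists i, nu i = 1 /\ forall j, 0 < nu j -> j = i.

Definition is_simple_eigenvalue q (mu : C) (P : 'M[{poly C}]_q) : Prop :=
  is_simple_zero mu (poly_ratmx P).

Definition right_eigenvector q (mu : C) (P : 'M[{poly C}]_q) (v : 'cV[C]_q) :
  Prop := v != 0 /\ horner_mx_at mu P *m v = 0.

Definition right_root_vector q (mu : C) (M : 'M[ratf]_q) (x : 'cV[ratf]_q) :
  Prop :=
  [/\ ratmx_no_pole mu x, ratmx_eval mu x != 0 &
      forall i, ratf_eval z ((M *m x) i 0) @[z --> mu^'] --> (0 : C)].

Definition left_root_vector q (mu : C) (M : 'M[ratf]_q) (y : 'cV[ratf]_q) :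
  Prop :=
  [/\ ratmx_no_pole mu y, ratmx_eval mu y != 0 &
      forall j, ratf_eval z ((y^T *m M) 0 j) @[z --> mu^'] --> (0 : C)].

Definition system_matrix n p (A : 'M[{poly C}]_n) (B : 'M[{poly C}]_(n, p))
    (C' : 'M[{poly C}]_(p, n)) (D : 'M[{poly C}]_p) : 'M[{poly C}]_(n + p) :=
  block_mx (- A) B C' D.

(* Meaningful for regular A: invmx M = M when M is not invertible. *)
Definition transfer_function n p (A : 'M[{poly C}]_n) (B : 'M[{poly C}]_(n, p))
    (C' : 'M[{poly C}]_(p, n)) (D : 'M[{poly C}]_p) : 'M[ratf]_p :=
  poly_ratmx D + poly_ratmx C' *m invmx (poly_ratmx A) *m poly_ratmx B.

Definition minimal_at n p (mu : C) (A : 'M[{poly C}]_n)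
    (B : 'M[{poly C}]_(n, p)) (C' : 'M[{poly C}]_(p, n)) : Prop :=
  \rank (col_mx (- horner_mx_at mu A) (horner_mx_at mu C')) = n /\
  \rank (row_mx (horner_mx_at mu A) (horner_mx_at mu B)) = n.

(* The coefficient of epsilon in the expansion of the transfer function of the
   perturbed system. *)
Definition transfer_variation n p (A dA : 'M[{poly C}]_n)
    (B dB : 'M[{poly C}]_(n, p)) (C' dC : 'M[{poly C}]_(p, n))
    (dD : 'M[{poly C}]_p) : 'M[ratf]_p :=
  let Ai := invmx (poly_ratmx A) in
  poly_ratmx dD + poly_ratmx dC *m Ai *m poly_ratmx B
  + poly_ratmx C' *m Ai *m poly_ratmx dB
  - poly_ratmx C' *m Ai *m poly_ratmx dA *m Ai *m poly_ratmx B.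

Definition perturb m n (e : C) (M dM : 'M[{poly C}]_(m, n)) :
  'M[{poly C}]_(m, n) := M + e%:P *: dM.

End RationalMatrices.

(* Main.v *)
Require Import Defs.
From mathcomp Require Import fingroup perm ring lra zify.
Import Order.TTheory GRing.Theory Num.Theory.
Local Open Scope classical_set_scope.
Local Open Scope complex_scope.
Local Open Scope ring_scope.

Local Notation normc := ComplexField.Normc.normc.

(** Write t for the local parameter at lambda0, G for the transfer function and
    d for the displacement of the eigenvalue.

    Kernel vectors and root vectors. If X and x are pole-free at lambda0 and
    A X = B x, then P maps the stacked vector (X, x) to (0, G x). A root vector
    of G is thus the output part of such a pair whose value at lambda0 is in the
    kernel of P(lambda0). Minimality makes this work in both respects: full row
    rank of (A B) extends a kernel vector to a pair ([state_lift]), and full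
    column rank of the other block keeps the output part from vanishing at
    lambda0 ([root_vector_lift]). Left root vectors come from the transposed
    system.

    The perturbed eigenvalue is a zero. Regularity and minimality are open
    conditions, so for small e the perturbed system is minimal at lambda0 + d
    and has a root vector there. A regular rational matrix with a root vector
    has a positive structural index, since otherwise its inverse would be
    pole-free ([root_vector_zero], on top of [local_smith_exists]).

    The quotient. G' is the variation of G along P' in the sense in which dG is
    its variation along dP ([ratmx_deriv_transfer]). On the lifted pairs u and w
    of right and left eigenvectors v0 and w0, both variations collapse to
    bilinear forms, w^T P' u and w^T dP u ([transfer_variation_form]). The
    quotient therefore tends to w0^T dP v0 / w0^T P' v0 at lambda0, provided
    that the denominator is nonzero, which is what simplicity gives
    ([simple_eigenvalue_data]).

    The displacement. Bordering P(lambda0) to an invertible matrix gives the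
    perturbed kernel vector as a polynomial expression in d and e. Multiplied by
    w0^T, the eigenvalue equation becomes d * alpha + e * beta = 0, where alpha
    and beta tend to a common nonzero multiple of w0^T P' v0 and w0^T dP v0
    ([perturbation_relation]). Dividing gives the modulus of d up to o(e). *)

Set Implicit Arguments.
Unset Strict Implicit.
Unset Printing Implicit Defensive.

(** * Values of rational matrices at a point *)

Section LocalRing.
Variable K : numFieldType.
Local Notation ratf := {fraction {poly K}}.
Variable z : K.
Implicit Types (f g : ratf) (a b : K).

(** Absence of a pole and value in a single relation: in this form the local
    ring at [z] and its residue map are handled together, and every closure
    property is one statement about sums, products or inverses. *)
Definition has_value f a : Prop := no_pole z f /\ ratf_eval z f = a.

Lemma has_valueP f a :
  has_value f a <->
  exists p q : {poly K}, [/\ q.[z] != 0, f = p%:F / q%:F & a = p.[z] / q.[z]].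
Proof.
split=> [[zf <-]|[p [q [qz -> ->]]]]; last exact: ratf_evalE.
by exists (ratf_num f), (ratf_den f); split=> //; apply: ratf_num_div_den.
Qed.

Lemma has_value_uniq f a b : has_value f a -> has_value f b -> a = b.
Proof. by move=> [_ <-] [_ <-]. Qed.

Lemma has_value_poly p : has_value p%:F p.[z].
Proof.
apply/has_valueP; exists p, 1; split; first by rewrite hornerC oner_neq0.
  by rewrite tofrac1 divr1.
by rewrite hornerC divr1.
Qed.

Lemma has_value_const a : has_value (a%:P)%:F a.
Proof. by have := has_value_poly a%:P; rewrite hornerC. Qed.

Lemma has_value0 : has_value 0 0.
Proof. by have := has_value_const 0; rewrite polyC0 tofrac0. Qed.

Lemma has_value1 : has_value 1 1.
Proof. by have := has_value_const 1; rewrite polyC1 tofrac1. Qed.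

Let tofrac_neq0 (q : {poly K}) : q.[z] != 0 -> q%:F != 0.
Proof. by rewrite tofrac_eq0; apply: contraNneq => ->; rewrite horner0. Qed.

Lemma has_valueD f g a b :
  has_value f a -> has_value g b -> has_value (f + g) (a + b).
Proof.
move=> /has_valueP[p [q [qz -> ->]]] /has_valueP[r [s [sz -> ->]]].
apply/has_valueP; exists (p * s + r * q), (q * s).
split; first by rewrite hornerM mulf_neq0.
  by rewrite addf_div ?tofrac_neq0 // tofracD !tofracM.
by rewrite addf_div // hornerD !hornerM.
Qed.

Lemma has_valueM f g a b :
  has_value f a -> has_value g b -> has_value (f * g) (a * b).
Proof.
move=> /has_valueP[p [q [qz -> ->]]] /has_valueP[r [s [sz -> ->]]].
apply/has_valueP; exists (p * r), (q * s).
split; first by rewrite hornerM mulf_neq0.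
  by rewrite mulf_div !tofracM.
by rewrite mulf_div !hornerM.
Qed.

Lemma has_valueN f a : has_value f a -> has_value (- f) (- a).
Proof.
move=> fa; rewrite -[- f]mulN1r -[- a]mulN1r; apply: has_valueM => //.
by have := has_value_const (-1); rewrite polyCN tofracN polyC1 tofrac1.
Qed.

Lemma has_valueV f a : a != 0 -> has_value f a -> has_value f^-1 a^-1.
Proof.
move=> a0 /has_valueP[p [q [qz -> aE]]]; apply/has_valueP; exists q, p.
rewrite aE !invf_div; split=> //; apply: contraNneq a0 => pz.
by rewrite aE pz mul0r.
Qed.

Lemma has_value_div f g a b :
  b != 0 -> has_value f a -> has_value g b -> has_value (f / g) (a / b).
Proof. by move=> b0 fa gb; apply: has_valueM fa _; apply: has_valueV. Qed.

Lemma has_value_sum I (r : seq I) (P : pred I) (F : I -> ratf) (c : I -> K) :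
  (forall i, P i -> has_value (F i) (c i)) ->
  has_value (\sum_(i <- r | P i) F i) (\sum_(i <- r | P i) c i).
Proof.
move=> Fc; elim/big_ind2: _ => //; first exact: has_value0.
by move=> *; apply: has_valueD.
Qed.

Lemma has_value_prod I (r : seq I) (P : pred I) (F : I -> ratf) (c : I -> K) :
  (forall i, P i -> has_value (F i) (c i)) ->
  has_value (\prod_(i <- r | P i) F i) (\prod_(i <- r | P i) c i).
Proof.
move=> Fc; elim/big_ind2: _ => //; first exact: has_value1.
by move=> *; apply: has_valueM.
Qed.

Lemma has_value_sign (k : nat) f a :
  has_value f a -> has_value ((-1) ^+ k * f) ((-1) ^+ k * a).
Proof.
move=> fa; rewrite -[X in has_value (X * _) _]signr_odd.
rewrite -[X in has_value _ (X * _)]signr_odd.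
by case: (odd k); rewrite ?mulN1r ?mul1r //; apply: has_valueN.
Qed.

Definition mx_has_value m n (M : 'M[ratf]_(m, n)) (M0 : 'M[K]_(m, n)) : Prop :=
  forall i j, has_value (M i j) (M0 i j).

Lemma mx_has_valueP m n (M : 'M[ratf]_(m, n)) M0 :
  mx_has_value M M0 <-> ratmx_no_pole z M /\ ratmx_eval z M = M0.
Proof.
split=> [MM0|[zM <-] i j]; last by rewrite mxE; split=> //; apply: zM.
split=> [i j|]; first by have [] := MM0 i j.
by apply/matrixP => i j; rewrite mxE; have [] := MM0 i j.
Qed.

Lemma mx_has_value_uniq m n (M : 'M[ratf]_(m, n)) M0 M1 :
  mx_has_value M M0 -> mx_has_value M M1 -> M0 = M1.
Proof. by move=> /mx_has_valueP[_ <-] /mx_has_valueP[_ <-]. Qed.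

Lemma mx_has_value_poly m n (M : 'M[{poly K}]_(m, n)) :
  mx_has_value (poly_ratmx M) (horner_mx_at z M).
Proof. by move=> i j; rewrite !mxE; apply: has_value_poly. Qed.

(** Constants are embedded through polynomials, so that the lemmas on
    [poly_ratmx] apply to them. *)
Definition const_ratmx m n (M0 : 'M[K]_(m, n)) : 'M[ratf]_(m, n) :=
  poly_ratmx (map_mx polyC M0).

Lemma mx_has_value_const m n (M0 : 'M[K]_(m, n)) :
  mx_has_value (const_ratmx M0) M0.
Proof. by move=> i j; rewrite !mxE; apply: has_value_const. Qed.

Lemma mx_has_value0 m n : mx_has_value (0 : 'M[ratf]_(m, n)) 0.
Proof. by move=> i j; rewrite !mxE; apply: has_value0. Qed.

Lemma mx_has_value_scalar n f a :
  has_value f a -> mx_has_value (f%:M : 'M[ratf]_n) a%:M.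
Proof. by move=> fa i j; rewrite !mxE; case: eqP => _ //; apply: has_value0. Qed.

Lemma mx_has_value1 n : mx_has_value (1%:M : 'M[ratf]_n) 1%:M.
Proof. exact/mx_has_value_scalar/has_value1. Qed.

Lemma mx_has_valueD m n (M N : 'M[ratf]_(m, n)) M0 N0 :
  mx_has_value M M0 -> mx_has_value N N0 -> mx_has_value (M + N) (M0 + N0).
Proof. by move=> MM0 NN0 i j; rewrite !mxE; apply: has_valueD. Qed.

Lemma mx_has_valueN m n (M : 'M[ratf]_(m, n)) M0 :
  mx_has_value M M0 -> mx_has_value (- M) (- M0).
Proof. by move=> MM0 i j; rewrite !mxE; apply: has_valueN. Qed.

Lemma mx_has_valueB m n (M N : 'M[ratf]_(m, n)) M0 N0 :
  mx_has_value M M0 -> mx_has_value N N0 -> mx_has_value (M - N) (M0 - N0).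
Proof. by move=> ? ?; apply: mx_has_valueD => //; apply: mx_has_valueN. Qed.

Lemma mx_has_valueM m n r (M : 'M[ratf]_(m, n)) (N : 'M[ratf]_(n, r)) M0 N0 :
  mx_has_value M M0 -> mx_has_value N N0 -> mx_has_value (M *m N) (M0 *m N0).
Proof.
move=> MM0 NN0 i j; rewrite !mxE.
by apply: has_value_sum => k _; apply: has_valueM.
Qed.

Lemma mx_has_valueZ m n f a (M : 'M[ratf]_(m, n)) M0 :
  has_value f a -> mx_has_value M M0 -> mx_has_value (f *: M) (a *: M0).
Proof. by move=> fa MM0 i j; rewrite !mxE; apply: has_valueM. Qed.

Lemma mx_has_value_tr m n (M : 'M[ratf]_(m, n)) M0 :
  mx_has_value M M0 -> mx_has_value M^T M0^T.
Proof. by move=> MM0 i j; rewrite !mxE. Qed.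

Lemma mx_has_value_col m1 m2 n (M : 'M[ratf]_(m1, n)) (N : 'M[ratf]_(m2, n))
    M0 N0 :
  mx_has_value M M0 -> mx_has_value N N0 ->
  mx_has_value (col_mx M N) (col_mx M0 N0).
Proof. by move=> MM0 NN0 i j; rewrite !mxE; case: (fintype.split i). Qed.

Lemma mx_has_value_block m1 m2 n1 n2 (M1 : 'M[ratf]_(m1, n1)) 
    (M2 : 'M[ratf]_(m1, n2)) (M3 : 'M[ratf]_(m2, n1)) (M4 : 'M[ratf]_(m2, n2))
    N1 N2 N3 N4 :
  mx_has_value M1 N1 -> mx_has_value M2 N2 ->
  mx_has_value M3 N3 -> mx_has_value M4 N4 ->
  mx_has_value (block_mx M1 M2 M3 M4) (block_mx N1 N2 N3 N4).
Proof.
move=> h1 h2 h3 h4 i j.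
by rewrite !mxE; case: (fintype.split i) => i'; rewrite !mxE;
  case: (fintype.split j) => j'.
Qed.

Lemma has_value_det n (M : 'M[ratf]_n) M0 :
  mx_has_value M M0 -> has_value (\det M) (\det M0).
Proof.
move=> MM0; rewrite /determinant; apply: has_value_sum => s _.
by apply: has_value_sign; apply: has_value_prod.
Qed.

Lemma mx_has_value_unit n (M : 'M[ratf]_n) M0 :
  mx_has_value M M0 -> M0 \in unitmx -> M \in unitmx.
Proof.
move=> /has_value_det Md; rewrite !unitmxE !unitfE; apply: contraNneq => M0d.
by rewrite M0d in Md; rewrite -(has_value_uniq has_value0 Md).
Qed.

(** Cramer's rule: the entries of the inverse are minors divided by the
    determinant, whose value at [z] is a nonzero scalar. *)
Lemma mx_has_value_inv n (M : 'M[ratf]_n) M0 :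
  mx_has_value M M0 -> M0 \in unitmx -> mx_has_value (invmx M) (invmx M0).
Proof.
move=> MM0 M0u; have Mu := mx_has_value_unit MM0 M0u.
rewrite /invmx Mu M0u; apply: mx_has_valueZ.
  by apply: has_valueV (has_value_det MM0); rewrite -unitfE -unitmxE.
move=> i j; rewrite !mxE; apply: has_value_sign.
by apply: has_value_det => k l; rewrite !mxE.
Qed.

Lemma invertible_atP q (G : 'M[ratf]_q) :
  invertible_at z G <-> exists2 G0, mx_has_value G G0 & G0 \in unitmx.
Proof.
split=> [[zG Gd]|[G0 /mx_has_valueP[zG <-]]].
  exists (ratmx_eval z G); first exact/mx_has_valueP.
  by rewrite unitmxE unitfE.
by rewrite unitmxE unitfE.
Qed.

Lemma invertible_at_unit q (G : 'M[ratf]_q) : invertible_at z G -> G \in unitmx.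
Proof. by case/invertible_atP => G0; apply: mx_has_value_unit. Qed.

Lemma invertible_at1 q : invertible_at z (1%:M : 'M[ratf]_q).
Proof.
by apply/invertible_atP; exists 1%:M; [apply: mx_has_value1|apply: unitmx1].
Qed.

Lemma invertible_atM q (G H : 'M[ratf]_q) :
  invertible_at z G -> invertible_at z H -> invertible_at z (G *m H).
Proof.
move=> /invertible_atP[G0 GG0 Gu] /invertible_atP[H0 HH0 Hu].
apply/invertible_atP; exists (G0 *m H0); first exact: mx_has_valueM.
by rewrite unitmx_mul Gu.
Qed.

End LocalRing.

(** * Local Smith form of a regular rational matrix *)

Section LocalSmith.
Variable K : numFieldType.
Local Notation ratf := {fraction {poly K}}.
Variable z : K.
Local Notation t := (('X - z%:P)%:F : ratf).

Lemma uniformizer_neq0 : t != 0.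
Proof. by rewrite tofrac_eq0 polyXsubC_eq0. Qed.

Lemma has_value_uniformizer : has_value z t 0.
Proof. by have := has_value_poly z ('X - z%:P); rewrite hornerXsubC subrr. Qed.

Lemma has_value_uniformizerX (k : nat) : has_value z (t ^+ k) (0 ^+ k).
Proof.
have := has_value_poly z (('X - z%:P) ^+ k).
by rewrite tofracXn horner_exp hornerXsubC subrr.
Qed.

(** For [k < 0] the value [a] of [t ^ k] would satisfy [0 * a = 1], since [t]
    has value [0] and [t ^+ (- k) * t ^ k = 1]. *)
Lemma has_value_uniformizer_exp (k : int) a : has_value z (t ^ k) a -> 0 <= k.
Proof.
case: k => // k; rewrite NegzE => ta; exfalso.
have := has_valueM (has_value_uniformizerX k.+1) ta.
rewrite -exprnN divff ?expf_neq0 ?uniformizer_neq0 // => /has_value_uniq.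
move=> /(_ 1 (has_value1 z)) /eqP; rewrite expr0n mul0r eq_sym.
by rewrite oner_eq0.
Qed.

Lemma ratf_factor (f : ratf) : f != 0 ->
  exists (k : int) (g : ratf), f = t ^ k * g /\ exists2 a, has_value z g a & a != 0.
Proof.
move=> f0; have fE := ratf_num_div_den f.
have D0 := ratf_den_neq0 f.
have N0 : ratf_num f != 0.
  by apply: contraNneq f0 => N0; rewrite fE N0 tofrac0 mul0r.
have [m [p]] := multiplicity_XsubC (ratf_num f) z.
rewrite N0 /root /= => pz NE.
have [l [q]] := multiplicity_XsubC (ratf_den f) z.
rewrite D0 /root /= => qz DE.
exists (m%:Z - l%:Z), (p%:F / q%:F); split.
  rewrite {1}fE NE DE !tofracM !tofracXn expfzDr ?uniformizer_neq0 //.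
  by rewrite -exprnP -exprnN invfM; ring.
exists (p.[z] / q.[z]); last by rewrite mulf_neq0 ?invr_eq0.
by apply: has_value_div => //; apply: has_value_poly.
Qed.

(** [k] is the least valuation among the nonzero entries; an entry that attains
    it becomes nonzero at [z] after division by [t ^ k]. *)
Lemma ratmx_factor m n (M : 'M[ratf]_(m, n)) : M != 0 ->
  exists (k : int) (N : 'M[ratf]_(m, n)) (N0 : 'M[K]_(m, n)),
    [/\ M = t ^ k *: N, mx_has_value z N N0 & N0 != 0].
Proof.
move=> M0; have t0 := uniformizer_neq0.
have [[i0 j0] Mij0] : exists ij : 'I_m * 'I_n, M ij.1 ij.2 != 0.
  apply: contra_neqP M0 => MN; apply/matrixP => i j; rewrite mxE.
  by apply: contra_notP MN => /eqP ?; exists (i, j).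
have /choice[v vP] : forall ij : 'I_m * 'I_n, exists k : int,
    M ij.1 ij.2 != 0 -> exists (g : ratf), M ij.1 ij.2 = t ^ k * g /\
      exists2 a, has_value z g a & a != 0.
  move=> ij; case: (eqVneq (M ij.1 ij.2) 0) => [_|Mij]; first by exists 0.
  by have [k [g gP]] := ratf_factor Mij; exists k => _; exists g.
pose ijm := [arg min_(ij < (i0, j0) | M ij.1 ij.2 != 0) v ij]%O.
have : exists ij, M ij.1 ij.2 != 0 /\
    forall kl, M kl.1 kl.2 != 0 -> v ij <= v kl.
  by exists ijm; rewrite /ijm; case: Order.TotalTheory.arg_minP.
move=> {ijm}[[i j] /= [Mij vmin]].
have NP : forall kl : 'I_m * 'I_n,
    exists b, has_value z (t ^ (- v (i, j)) * M kl.1 kl.2) b /\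
             (kl = (i, j) -> b != 0).
  move=> kl; case: (eqVneq (M kl.1 kl.2) 0) => [Mkl|Mkl].
    exists 0; split; first by rewrite Mkl mulr0; apply: has_value0.
    by move=> klE; move: Mij; rewrite klE /= in Mkl; rewrite Mkl eqxx.
  have [g [-> [a ga a0]]] := vP kl Mkl.
  have [d dE] : exists d : nat, - v (i, j) + v kl = d.
    by have := vmin _ Mkl; exists (absz (- v (i, j) + v kl)); lia.
  exists (0 ^+ d * a); rewrite mulrA -(expfzDr _ _ t0) dE; split.
    by apply: has_valueM ga; apply: has_value_uniformizerX.
  move=> klE; move: dE; rewrite klE addNr => -[<-].
  by rewrite expr0 mul1r.
have [b bP] := choice NP.
exists (v (i, j)), (t ^ (- v (i, j)) *: M), (\matrix_(k, l) b (k, l)); split.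
- by rewrite scalerA -(expfzDr _ _ t0) subrr expr0z scale1r.
- by move=> k l; rewrite !mxE; have [] := bP (k, l).
- have [_ /(_ erefl)] := bP (i, j); apply: contraNneq => /matrixP/(_ i j).
  by rewrite !mxE => ->.
Qed.

Lemma block_diag_invertible_at q (H : 'M[ratf]_q) :
  invertible_at z H ->
  invertible_at z (block_mx 1%:M 0 0 H : 'M[ratf]_(1 + q)).
Proof.
move=> /invertible_atP[H0 HH0 Hu]; apply/invertible_atP.
exists (block_mx 1%:M 0 0 H0).
  by apply: mx_has_value_block => //; [apply: mx_has_value1|apply: mx_has_value0..].
by rewrite unitmxE det_ublock unitrM det1 unitr1 /= -unitmxE.
Qed.

Lemma invertible_at_perm q (s : {perm 'I_q}) :
  invertible_at z (perm_mx s : 'M[ratf]_q).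
Proof.
apply/invertible_atP; exists (perm_mx s); last exact: unitmx_perm.
move=> i j; rewrite !mxE.
by case: eqP => _; [apply: has_value1|apply: has_value0].
Qed.

(** One elimination step over the local ring at [z]: an entry with a nonzero
    value is a unit there, so dividing by it stays pole-free. *)
Lemma local_pivot q (M : 'M[ratf]_(1 + q)) (M0 : 'M[K]_(1 + q)) :
  mx_has_value z M M0 -> M0 != 0 ->
  exists G1 G2 (S : 'M[ratf]_q),
    [/\ invertible_at z G1, invertible_at z G2,
        G1 *m M *m G2 = block_mx 1%:M 0 0 S & exists S0, mx_has_value z S S0].
Proof.
move=> MM0 M00.
have [[i j] /= Mij] : exists ij : 'I_(1 + q) * 'I_(1 + q), M0 ij.1 ij.2 != 0.
  apply: contra_neqP M00 => MN; apply/matrixP => i j; rewrite mxE.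
  by apply: contra_notP MN => /eqP ?; exists (i, j).
pose T1 := perm_mx (tperm (0 : 'I_(1 + q)) i) : 'M[ratf]_(1 + q).
pose T2 := perm_mx (tperm (0 : 'I_(1 + q)) j) : 'M[ratf]_(1 + q).
have T1P : invertible_at z T1 := invertible_at_perm _.
have T2P : invertible_at z T2 := invertible_at_perm _.
set N := T1 *m M *m T2.
have NE k l : N k l = M (tperm 0 i k) (tperm 0 j l).
  by rewrite /N -row_permE /T2 -(tpermV 0 j) -col_permE !mxE tpermV.
pose N0 : 'M[K]_(1 + q) := \matrix_(k, l) M0 (tperm 0 i k) (tperm 0 j l).
have NN0 : mx_has_value z N N0 by move=> k l; rewrite NE mxE.
pose f : ratf := N 0 0; pose a : K := N0 0 0.
have fa : has_value z f a by exact: NN0.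
have a0 : a != 0 by rewrite /a mxE !tpermL.
have f0 : f != 0.
  by apply: contra_neq a0 => f0; apply: has_value_uniq fa _; rewrite f0;
    apply: has_value0.
pose r := ursubmx N; pose c := dlsubmx N; pose D := drsubmx N.
have sub (m1 m2 n1 n2 : nat) (X : 'M[ratf]_(m1 + m2, n1 + n2)) X0 :
    mx_has_value z X X0 ->
    [/\ mx_has_value z (ursubmx X) (ursubmx X0),
        mx_has_value z (dlsubmx X) (dlsubmx X0) &
        mx_has_value z (drsubmx X) (drsubmx X0)].
  by move=> XX0; split=> k l; rewrite !mxE.
have [rr0 cc0 DD0] := sub _ _ _ _ _ _ NN0.
have NB : N = block_mx f%:M r c D.
  rewrite -[LHS]submxK; congr block_mx.
  apply/matrixP => k l; rewrite !ord1 [RHS]mxE eqxx mulr1n [LHS]mxE [LHS]mxE.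
  by rewrite /f; congr (fun_of_matrix N _ _); apply/val_inj.
pose L : 'M[ratf]_(1 + q) := block_mx (f^-1)%:M 0 (- (f^-1 *: c)) 1%:M.
pose U : 'M[ratf]_(1 + q) := block_mx 1%:M (- (f^-1 *: r)) 0 1%:M.
have fV := has_valueV a0 fa.
exists (L *m T1), (T2 *m U), (D - f^-1 *: (c *m r)).
have LP : invertible_at z L.
  apply/invertible_atP; exists (block_mx (a^-1)%:M 0 (- (a^-1 *: dlsubmx N0)) 1%:M).
    apply: mx_has_value_block; last exact: mx_has_value1.
    - exact: mx_has_value_scalar.
    - exact: mx_has_value0.
    - by apply: mx_has_valueN; apply: mx_has_valueZ.
  by rewrite unitmxE det_lblock unitrM det1 unitr1 andbT det_scalar1 unitrV unitfE.
have UP : invertible_at z U.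
  apply/invertible_atP; exists (block_mx 1%:M (- (a^-1 *: ursubmx N0)) 0 1%:M).
    apply: mx_has_value_block; try exact: mx_has_value1.
    - by apply: mx_has_valueN; apply: mx_has_valueZ.
    - exact: mx_has_value0.
  by rewrite unitmxE det_ublock unitrM !det1 unitr1.
split.
- exact: invertible_atM.
- exact: invertible_atM.
- rewrite mulmxA -(mulmxA L) -(mulmxA L) -/N NB /L /U !mulmx_block.
  have row0 : (f^-1)%:M *m f%:M = 1%:M :> 'M[ratf]_1 by rewrite -scalar_mxM mulVf.
  have col0 : - (f^-1 *: c) *m f%:M + 1%:M *m c = 0.
    by rewrite mul_mx_scalar mul1mx scalerN scalerA divff // scale1r addNr.
  rewrite col0 row0 !mul0mx !mulmx1 !mulmx0 !addr0 !mul1mx add0r.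
  by rewrite mul_scalar_mx addNr mulNmx -scalemxAl [_ + D]addrC.
- exists (drsubmx N0 - a^-1 *: (dlsubmx N0 *m ursubmx N0)).
  by apply: mx_has_valueB => //; apply: mx_has_valueZ => //; apply: mx_has_valueM.
Qed.

(** By induction on the size. Once the smallest power of [t] is factored out
    the pivot is a unit, and the Schur complement of the pivot stays pole-free;
    its exponents are therefore nonnegative, and the exponents come out
    sorted. *)
Lemma local_smith_exists q (M : 'M[ratf]_q) :
  regular M -> exists nu, local_smith z M nu.
Proof.
rewrite /regular -unitfE -unitmxE.
elim: q M => [M _|q IHq].
  exists (fun=> 0); split=> [[]//|]; exists 1%:M, 1%:M.
  by split; [exact: invertible_at1..|apply/matrixP=> -[]].
rewrite -[q.+1]/(1 + q)%N => M Mu.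
have M0 : M != 0 by apply: contraTneq Mu => ->; rewrite unitmxE det0 unitr0.
have [k [N [N0 [ME NN0 N00]]]] := ratmx_factor M0.
have [G1 [G2 [S [G1P G2P NE [S0 SS0]]]]] := @local_pivot q N N0 NN0 N00.
have t0 := uniformizer_neq0; have tk0 : t ^ k != 0 by rewrite expfz_neq0.
have Su : S \in unitmx.
  have : G1 *m N *m G2 \in unitmx.
    rewrite !unitmx_mul (invertible_at_unit G1P) (invertible_at_unit G2P) andbT.
    by move: Mu; rewrite ME unitmxZ // unitfE.
  by rewrite NE !unitmxE det_ublock det1 mul1r; apply.
have [nu [nu_sorted [H1 [H2 [H1P H2P SE]]]]] := IHq S Su.
(* The pole-free matrix [H1 *m S *m H2] has the entry [t ^ nu i]. *)
have nu_ge0 i : 0 <= nu i.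
  have /invertible_atP[H10 H1v _] := H1P; have /invertible_atP[H20 H2v _] := H2P.
  have := mx_has_valueM (mx_has_valueM H1v SS0) H2v; rewrite SE => /(_ i i).
  by rewrite !mxE eqxx mulr1n => /has_value_uniformizer_exp.
exists (fun i : 'I_(1 + q) => k + if fintype.split i is inr j then nu j else 0).
split=> [i j|].
  rewrite lerD2l; case: splitP => i' iE; case: splitP => j' jE //.
    by rewrite iE jE !ord1 /= leqn0 addn_eq0.
  by rewrite iE jE leq_add2l; apply: nu_sorted.
exists (block_mx 1%:M 0 0 H1 *m G1), (G2 *m block_mx 1%:M 0 0 H2); split.
- by apply: invertible_atM => //; apply: block_diag_invertible_at.
- by apply: invertible_atM => //; apply: block_diag_invertible_at.
rewrite ME -scalemxAr -scalemxAl !mulmxA.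
rewrite -(mulmxA (block_mx _ _ _ H1)) -(mulmxA (block_mx _ _ _ H1)) NE.
rewrite !mulmx_block !mulmx0 !mul0mx !mulmx1 ?mul1mx !addr0 !add0r SE.
apply/matrixP => i j; rewrite !mxE; case: splitP => i' iE; rewrite !mxE.
  case: splitP => j' jE; rewrite ?mul0mx !mxE addr0.
    by rewrite -!val_eqE /= iE jE mulr_natr.
  by rewrite mulr0 -val_eqE /= iE jE ord1.
case: splitP => j' jE; rewrite !mxE.
  by rewrite mulr0 -val_eqE /= iE jE ord1.
by rewrite -[i == j]val_eqE /= iE jE eqn_add2l val_eqE mulrnAr -(expfzDr _ _ t0).
Qed.

End LocalSmith.

(** * Differentiation of rational matrices *)

Section Derivation.
Variable K : numFieldType.
Local Notation ratf := {fraction {poly K}}.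
Implicit Types f g : ratf.

Lemma ratf_fracP f : exists p q : {poly K}, q != 0 /\ f = p%:F / q%:F.
Proof.
by exists (ratf_num f), (ratf_den f); split;
  rewrite ?ratf_den_neq0 // -ratf_num_div_den.
Qed.

Lemma ratf_deriv_poly p : ratf_deriv p%:F = (p^`() : {poly K})%:F.
Proof.
have := ratf_derivE p (oner_neq0 {poly K}).
by rewrite tofrac1 divr1 => ->;
  rewrite derivC mulr0 subr0 mulr1 expr1n tofrac1 divr1.
Qed.

Lemma ratf_derivD f g : ratf_deriv (f + g) = ratf_deriv f + ratf_deriv g.
Proof.
have [p [q [q0 ->]]] := ratf_fracP f; have [r [s [s0 ->]]] := ratf_fracP g.
have F0 (h : {poly K}) : h != 0 -> h%:F != 0 by rewrite tofrac_eq0.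
rewrite addf_div ?F0 // -!tofracM -tofracD !ratf_derivE ?mulf_neq0 //.
rewrite addf_div ?F0 ?expf_neq0 // -!tofracM -tofracD.
apply/eqP; rewrite eqr_div ?F0 ?mulf_neq0 ?expf_neq0 ?mulf_neq0 //.
rewrite -!tofracM; apply/eqP; congr (_%:F).
by rewrite !derivD !derivM; ring.
Qed.

Lemma ratf_derivM f g :
  ratf_deriv (f * g) = ratf_deriv f * g + f * ratf_deriv g.
Proof.
have [p [q [q0 ->]]] := ratf_fracP f; have [r [s [s0 ->]]] := ratf_fracP g.
have F0 (h : {poly K}) : h != 0 -> h%:F != 0 by rewrite tofrac_eq0.
rewrite mulf_div -!tofracM !ratf_derivE ?mulf_neq0 // !mulf_div.
rewrite -!tofracM addf_div ?F0 ?mulf_neq0 ?expf_neq0 // -!tofracM -tofracD.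
apply/eqP; rewrite eqr_div ?F0 ?mulf_neq0 ?expf_neq0 ?mulf_neq0 //.
rewrite -!tofracM; apply/eqP; congr (_%:F).
by rewrite !derivM; ring.
Qed.

Lemma ratf_deriv_sum I (r : seq I) (P : pred I) (F : I -> ratf) :
  ratf_deriv (\sum_(i <- r | P i) F i) = \sum_(i <- r | P i) ratf_deriv (F i).
Proof.
apply: (big_morph _ ratf_derivD).
by rewrite -tofrac0 ratf_deriv_poly derivC tofrac0.
Qed.

Lemma ratmx_derivD m n (M N : 'M[ratf]_(m, n)) :
  ratmx_deriv (M + N) = ratmx_deriv M + ratmx_deriv N.
Proof. by apply/matrixP => i j; rewrite !mxE ratf_derivD. Qed.

Lemma ratmx_derivM m n r (M : 'M[ratf]_(m, n)) (N : 'M[ratf]_(n, r)) :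
  ratmx_deriv (M *m N) = ratmx_deriv M *m N + M *m ratmx_deriv N.
Proof.
apply/matrixP => i j; rewrite !mxE ratf_deriv_sum -big_split.
by apply: eq_bigr => k _; rewrite ratf_derivM !mxE.
Qed.

Lemma ratmx_deriv_poly m n (M : 'M[{poly K}]_(m, n)) :
  ratmx_deriv (poly_ratmx M) = poly_ratmx (map_mx (@deriv K) M).
Proof. by apply/matrixP => i j; rewrite !mxE ratf_deriv_poly. Qed.

Lemma ratmx_deriv1 n : ratmx_deriv (1%:M : 'M[ratf]_n) = 0.
Proof.
apply/matrixP => i j; rewrite !mxE.
by case: (i == j); rewrite -?tofrac1 -?tofrac0 ratf_deriv_poly derivC ?tofrac0.
Qed.

(** Differentiate [M *m invmx M = 1%:M]. *)
Lemma ratmx_derivV n (M : 'M[ratf]_n) : M \in unitmx ->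
  ratmx_deriv (invmx M) = - (invmx M *m ratmx_deriv M *m invmx M).
Proof.
move=> Mu; have := ratmx_derivM M (invmx M).
rewrite mulmxV // ratmx_deriv1 => /esym/eqP; rewrite addrC addr_eq0 => /eqP E.
by rewrite -(mulKmx Mu (ratmx_deriv _)) E mulmxN mulmxA.
Qed.

End Derivation.

(** * System matrices, transfer functions and root vectors *)

Section SystemMatrix.
Variable K : numFieldType.
Local Notation ratf := {fraction {poly K}}.
Variables (n p : nat).
Implicit Types (A dA : 'M[{poly K}]_n) (B dB : 'M[{poly K}]_(n, p)).
Implicit Types (C dC : 'M[{poly K}]_(p, n)) (D dD : 'M[{poly K}]_p).

Lemma poly_ratmxN m r (M : 'M[{poly K}]_(m, r)) :
  poly_ratmx (- M) = - poly_ratmx M.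
Proof. by apply/matrixP => i j; rewrite !mxE tofracN. Qed.

Lemma poly_ratmxM m r s (M : 'M[{poly K}]_(m, r)) (N : 'M[{poly K}]_(r, s)) :
  poly_ratmx (M *m N) = poly_ratmx M *m poly_ratmx N.
Proof. exact: map_mxM. Qed.

Lemma poly_ratmx_tr m r (M : 'M[{poly K}]_(m, r)) :
  poly_ratmx M^T = (poly_ratmx M)^T.
Proof. exact: esym (map_trmx _ _). Qed.

Lemma poly_ratmx_system A B C D : poly_ratmx (system_matrix A B C D) =
  block_mx (- poly_ratmx A) (poly_ratmx B) (poly_ratmx C) (poly_ratmx D).
Proof.
by rewrite /system_matrix /poly_ratmx map_block_mx -/(poly_ratmx _) poly_ratmxN.
Qed.

Lemma horner_mx_system z A B C D : horner_mx_at z (system_matrix A B C D) =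
  block_mx (- horner_mx_at z A) (horner_mx_at z B)
           (horner_mx_at z C) (horner_mx_at z D).
Proof. by rewrite /system_matrix /horner_mx_at map_block_mx map_mxN. Qed.

Lemma horner_mx_at_tr m r z (M : 'M[{poly K}]_(m, r)) :
  horner_mx_at z M^T = (horner_mx_at z M)^T.
Proof. exact: esym (map_trmx _ _). Qed.

Lemma regular_poly_ratmx m (M : 'M[{poly K}]_m) :
  regular M -> poly_ratmx M \in unitmx.
Proof. by rewrite unitmxE unitfE /poly_ratmx det_map_mx tofrac_eq0. Qed.

Lemma transfer_functionE r A B C D (X : 'M[ratf]_(n, r)) (x : 'M[ratf]_(p, r)) :
  regular A -> poly_ratmx A *m X = poly_ratmx B *m x ->
  transfer_function A B C D *m x = poly_ratmx C *m X + poly_ratmx D *m x.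
Proof.
move=> /regular_poly_ratmx Au E.
by rewrite mulmxDl addrC -!mulmxA -E mulKmx.
Qed.

(** The transfer function is the Schur complement of [- A] in the system
    matrix, so its determinant divides that of the system matrix. *)
Lemma regular_transfer A B C D :
  regular A -> regular (system_matrix A B C D) ->
  regular (transfer_function A B C D).
Proof.
move=> /regular_poly_ratmx Au /regular_poly_ratmx Pu.
pose L : 'M[ratf]_(n + p) :=
  block_mx 1%:M 0 (- (poly_ratmx C *m invmx (poly_ratmx A))) 1%:M.
pose U : 'M[ratf]_(n + p) :=
  block_mx (- poly_ratmx A) (poly_ratmx B) 0 (transfer_function A B C D).
have PE : poly_ratmx (system_matrix A B C D) = L *m U.
  rewrite poly_ratmx_system mulmx_block !mul1mx !mul0mx !addr0.
  rewrite mulmxN mulNmx opprK (mulmxKV Au) mulNmx.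
  by rewrite [transfer_function _ _ _ _]addrC addKr.
move: Pu; rewrite PE unitmxE det_mulmx det_lblock !det1 !mul1r det_ublock.
by rewrite unitrM => /andP[_]; rewrite unitfE.
Qed.

Lemma transfer_function_tr A B C D : regular A ->
  transfer_function A^T C^T B^T D^T = (transfer_function A B C D)^T.
Proof.
move=> Ar; rewrite /transfer_function !poly_ratmx_tr linearD /=.
by rewrite !trmx_mul trmx_inv mulmxA.
Qed.

Lemma system_matrix_tr A B C D :
  system_matrix A^T C^T B^T D^T = (system_matrix A B C D)^T.
Proof. by rewrite /system_matrix tr_block_mx linearN. Qed.

(** Differentiation in the variable follows the same product rule as the
    first-order expansion in the perturbation parameter. The derivative of the
    transfer function is thus its variation along the differentiated
    blocks, and one computation covers numerator and denominator of the
    quotient. *)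
Lemma ratmx_deriv_transfer A B C D : regular A ->
  ratmx_deriv (transfer_function A B C D) =
  transfer_variation A (map_mx (@deriv K) A) B (map_mx (@deriv K) B)
                     C (map_mx (@deriv K) C) (map_mx (@deriv K) D).
Proof.
move=> /regular_poly_ratmx Au; rewrite /transfer_function /transfer_variation.
rewrite ratmx_derivD !ratmx_derivM (ratmx_derivV Au) !ratmx_deriv_poly.
by rewrite mulmxN mulmxDl mulNmx !mulmxA -!addrA [- _ + _]addrC.
Qed.

(** The relations between states and outputs absorb every factor [invmx A],
    which leaves the bilinear form of the perturbing system matrix. On pole-free
    states and outputs that form is pole-free even where [A] is singular. *)
Lemma transfer_variation_form A dA B dB C dC dD r s
    (X : 'M[ratf]_(n, r)) (x : 'M[ratf]_(p, r))
    (W : 'M[ratf]_(n, s)) (y : 'M[ratf]_(p, s)) :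
  regular A -> poly_ratmx A *m X = poly_ratmx B *m x ->
  poly_ratmx A^T *m W = poly_ratmx C^T *m y ->
  y^T *m transfer_variation A dA B dB C dC dD *m x =
  (col_mx W y)^T *m poly_ratmx (system_matrix dA dB dC dD) *m col_mx X x.
Proof.
move=> /regular_poly_ratmx Au EX EW.
have {}EX : X = invmx (poly_ratmx A) *m poly_ratmx B *m x.
  by rewrite -mulmxA -EX mulKmx.
have {}EW : W^T = y^T *m poly_ratmx C *m invmx (poly_ratmx A).
  have := congr1 trmx EW; rewrite !trmx_mul -!poly_ratmx_tr !trmxK => <-.
  by rewrite mulmxK.
rewrite poly_ratmx_system tr_col_mx mul_row_block mul_row_col EW EX.
rewrite /transfer_variation !(mulmxDl, mulmxDr, mulmxN, mulNmx) !mulmxA.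
rewrite [LHS]addrC -[RHS]addrA; congr (_ + _).
by rewrite -[LHS]addrA [LHS]addrC -[LHS]addrA.
Qed.

(** Left root vectors are right root vectors of the transposed system; the
    only change of shape is the sign of the block [A]. *)
Lemma minimal_at_tr z A B C : minimal_at z A B C -> minimal_at z A^T C^T B^T.
Proof.
have trN m r (M : 'M[K]_(m, r)) : - M^T = (- M)^T by rewrite linearN.
rewrite /minimal_at !horner_mx_at_tr trN -tr_row_mx -tr_col_mx !mxrank_tr.
set A0 := horner_mx_at z A; set B0 := horner_mx_at z B.
set C0 := horner_mx_at z C => -[rC rB].
split; [rewrite -[RHS]rB|rewrite -[RHS]rC].
  have -> : row_mx (- A0) B0 = row_mx A0 B0 *m block_mx (-1)%:M 0 0 1%:M.
    by rewrite mul_row_block !mulmx0 mulmx1 addr0 add0r mul_mx_scalar scaleN1r.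
  rewrite mxrankMfree // row_free_unit unitmxE det_ublock det1 mulr1 det_scalar.
  by rewrite unitrX ?unitrN1.
have -> : col_mx A0 C0 = block_mx (-1)%:M 0 0 1%:M *m col_mx (- A0) C0.
  by rewrite mul_block_col !mul0mx mul1mx addr0 add0r mul_scalar_mx scaleN1r opprK.
rewrite (eqmxMfull _ _) // row_full_unit unitmxE det_ublock det1 mulr1 det_scalar.
by rewrite unitrX ?unitrN1.
Qed.

(** Take constants [L1], [L2] with [A(z) L1 + B(z) L2 = 1], given by full row
    rank. The matrix [T = A L1 + B L2] is invertible at [z], and correcting the
    constant pair [(a, b)] along [L1], [L2] by [T^-1] times the defect
    [A a - B b], which vanishes at [z], solves [A X = B x] exactly. *)
Lemma state_lift z A B C (a : 'cV[K]_n) (b : 'cV[K]_p) :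
  minimal_at z A B C -> horner_mx_at z A *m a = horner_mx_at z B *m b ->
  exists X x, [/\ poly_ratmx A *m X = poly_ratmx B *m x,
                  mx_has_value z X a & mx_has_value z x b].
Proof.
move=> [_ rAB] ab.
have /row_freeP[L] : row_free (row_mx (horner_mx_at z A) (horner_mx_at z B)).
  by rewrite /row_free rAB.
rewrite -[L]vsubmxK mul_row_col; set L1 := usubmx L; set L2 := dsubmx L => L12.
have Lv m r (M : 'M[K]_(m, r)) := mx_has_value_const z M.
have Pv m r (M : 'M[{poly K}]_(m, r)) := mx_has_value_poly z M.
pose T := poly_ratmx A *m const_ratmx L1 + poly_ratmx B *m const_ratmx L2.
have T1 : mx_has_value z T 1%:M.
  by rewrite -L12; apply: mx_has_valueD; apply: mx_has_valueM.
have Tu : T \in unitmx := mx_has_value_unit T1 (unitmx1 _ _).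
have TV := mx_has_value_inv T1 (unitmx1 _ _).
pose s := poly_ratmx A *m const_ratmx a - poly_ratmx B *m const_ratmx b.
have s0 : mx_has_value z s 0.
  by rewrite -(subrr (horner_mx_at z B *m b)) -[X in X - _]ab; apply: mx_has_valueB;
    apply: mx_has_valueM.
have [h h0 Th] : exists2 h, mx_has_value z h 0 & T *m h = s.
  exists (invmx T *m s); last exact: mulKVmx.
  by have := mx_has_valueM TV s0; rewrite mulmx0.
exists (const_ratmx a - const_ratmx L1 *m h).
exists (const_ratmx b + const_ratmx L2 *m h); split.
- apply/eqP; rewrite -subr_eq0 mulmxBr mulmxDr opprD addrACA -opprD !mulmxA.
  by rewrite -mulmxDl -/T -/s Th subrr.
- by have := mx_has_valueB (Lv _ _ a) (mx_has_valueM (Lv _ _ L1) h0);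
    rewrite mulmx0 subr0.
- by have := mx_has_valueD (Lv _ _ b) (mx_has_valueM (Lv _ _ L2) h0);
    rewrite mulmx0 addr0.
Qed.

(** The lift of a kernel vector of the system matrix: the output part cannot
    vanish at [z], for then the state part would be in the kernel of the full
    column rank matrix. The product with the transfer function equals the
    lower block of the system matrix applied to the lift. *)
Lemma root_vector_lift z A B C D (u : 'cV[K]_(n + p)) :
  regular A -> minimal_at z A B C -> u != 0 ->
  horner_mx_at z (system_matrix A B C D) *m u = 0 ->
  exists X x, [/\ poly_ratmx A *m X = poly_ratmx B *m x,
    mx_has_value z X (usubmx u), mx_has_value z x (dsubmx u), dsubmx u != 0 &
    mx_has_value z (transfer_function A B C D *m x) 0].
Proof.
move=> Ar mini u0; rewrite horner_mx_system -{1}[u]vsubmxK mul_block_col.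
set a := usubmx u; set b := dsubmx u => /eqP; rewrite col_mx_eq0 => /andP[].
rewrite mulNmx addrC subr_eq0 => /eqP/esym abA /eqP abC.
have [X [x [E Xa xb]]] := state_lift mini abA.
exists X, x; split=> //.
  apply: contraNneq u0 => b0; rewrite -[u]vsubmxK -/a -/b b0.
  have [/eqP rC _] := mini; have /row_fullP[L LE] := rC.
  suff -> : a = 0 by rewrite col_mx0.
  rewrite -[a]mul1mx -LE -mulmxA mul_col_mx mulNmx abA b0 mulmx0 oppr0.
  by move: abC; rewrite b0 mulmx0 addr0 => ->; rewrite col_mx0 mulmx0.
rewrite (transfer_functionE _ _ Ar E) -abC.
by apply: mx_has_valueD; apply: mx_has_valueM => //; apply: mx_has_value_poly.
Qed.

(** If no structural index were positive, the inverse of [M] would be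
    pole-free at [z], and [x = M^-1 (M x)] would vanish there. *)
Lemma root_vector_zero q z (M : 'M[ratf]_q) (x : 'cV[ratf]_q) (x0 : 'cV[K]_q) :
  regular M -> mx_has_value z x x0 -> x0 != 0 -> mx_has_value z (M *m x) 0 ->
  is_zero z M.
Proof.
move=> Mr xx0 x00 Mx; have [nu nuP] := local_smith_exists z Mr.
exists nu => //; apply: contra_neqP x00 => nu_le0.
have {}nu_le0 i : nu i <= 0.
  by rewrite leNgt; apply/negP => nui; apply: nu_le0; exists i.
have [_ [G1 [G2 [G1P G2P SE]]]] := nuP.
have [G10 G1v _] := (invertible_atP _ _).1 G1P.
have [G20 G2v _] := (invertible_atP _ _).1 G2P.
have G2u := invertible_at_unit G2P.
pose Dv : 'M[ratf]_q := diag_mx (\row_i ('X - z%:P)%:F ^ (- nu i)).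
have [D0 Dv0] : exists D0 : 'M[K]_q, mx_has_value z Dv D0.
  exists (diag_mx (\row_i 0 ^+ (absz (nu i)))) => i j; rewrite !mxE.
  case: eqP => _; rewrite ?mulr1n ?mulr0n; last exact: has_value0.
  have -> : - nu i = absz (nu i) by have := nu_le0 i; lia.
  exact: has_value_uniformizerX.
have DS : Dv *m G1 *m M *m G2 = 1%:M.
  rewrite -!mulmxA [G1 *m _]mulmxA SE mulmx_diag; apply/matrixP => i j.
  rewrite !mxE -expfzDr ?uniformizer_neq0 // addNr expr0z.
  by case: eqP.
have xE : x = G2 *m Dv *m G1 *m (M *m x).
  by rewrite !mulmxA -[G2 *m _ *m _]mulmxA -[G2 *m _ *m _]mulmxA (mulmx1C DS) mul1mx.
apply: mx_has_value_uniq xx0 _; rewrite xE -(mulmx0 _ (G20 *m D0 *m G10)).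
by apply: mx_has_valueM => //; apply: mx_has_valueM => //; apply: mx_has_valueM.
Qed.

End SystemMatrix.

(** * Eigenvectors at a simple eigenvalue *)

Section SimpleEigenvalue.
Variable K : numFieldType.
Local Notation ratf := {fraction {poly K}}.
Variables (q : nat) (z : K).

Lemma const_ratmxM m n r (M : 'M[K]_(m, n)) (N : 'M[K]_(n, r)) :
  const_ratmx (M *m N) = const_ratmx M *m const_ratmx N.
Proof. by rewrite /const_ratmx map_mxM poly_ratmxM. Qed.

(** The exact quotient [Q] replaces difference quotients: it is defined also
    when the increment is zero. *)
Lemma polymx_taylor m n (P : 'M[{poly K}]_(m, n)) :
  exists2 Q : 'M[{poly K}]_(m, n),
    P = map_mx polyC (horner_mx_at z P) + ('X - z%:P) *: Q &
    horner_mx_at z Q = horner_mx_at z (map_mx (@deriv K) P).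
Proof.
pose Q := \matrix_(i, j) ((P i j - ((P i j).[z])%:P) %/ ('X - z%:P)).
have QE i j : P i j = ((P i j).[z])%:P + ('X - z%:P) * Q i j.
  rewrite mxE mulrC divpK ?subrKC //.
  by rewrite dvdp_XsubCl /root hornerD hornerN hornerC subrr.
have dQE i j : (Q i j).[z] = ((P i j)^`()).[z].
  rewrite [in RHS]QE derivD derivC derivM derivXsubC add0r mul1r.
  by rewrite hornerD hornerM hornerXsubC subrr mul0r addr0.
exists Q; apply/matrixP => i j; first by rewrite [LHS]QE !mxE.
by rewrite mxE [horner_eval _ _]dQE !mxE.
Qed.

(** The other structural indices are not positive, hence zero because [P] is
    pole-free, so the local Smith form [G1 P G2] takes the value [1 - e e^T] at [z], where [e] is the
    basis vector at the index of the simple zero. The vectors [v], [w], [b],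
    [c] are [e] transported by [G1(z)], [G2(z)] and their inverses; adding
    [b c^T] restores the missing unit. The pairing with the derivative is [1]
    because [P G2 e = t G1^-1 e]: multiplied by [w^T], this reads
    [t w^T Q G2 e = t w^T G1^-1 e] for the exact quotient [Q] of
    [P - P(z)] by [t]. After division by [t] the right side has value
    [e^T G1 G1^-1 e = 1]. *)
Lemma simple_eigenvalue_data (P : 'M[{poly K}]_q) :
  is_simple_eigenvalue z P ->
  exists v w b c : 'cV[K]_q,
    [/\ horner_mx_at z P *m v = 0, w^T *m horner_mx_at z P = 0,
        (w^T *m horner_mx_at z (map_mx (@deriv K) P) *m v) 0 0 = 1,
        c^T *m v = 1%:M & horner_mx_at z P + b *m c^T \in unitmx].
Proof.
case=> nu [_ [G1 [G2 [G1P G2P SE]]]] [k [nuk nu_other]].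
have [G10 G1v G1u] := (invertible_atP _ _).1 G1P.
have [G20 G2v G2u] := (invertible_atP _ _).1 G2P.
set P0 := horner_mx_at z P; set PF := poly_ratmx P in SE *.
have Pv : mx_has_value z PF P0 := mx_has_value_poly z P.
have Ev := mx_has_valueM (mx_has_valueM G1v Pv) G2v.
have nu0 i : i != k -> nu i = 0.
  move=> ik; apply/eqP; rewrite eq_le; apply/andP; split.
    by rewrite leNgt; apply: contraNN ik => /nu_other ->.
  have := Ev i i; rewrite SE !mxE eqxx mulr1n.
  exact: has_value_uniformizer_exp.
pose e : 'cV[K]_q := delta_mx k 0.
have ee : e^T *m e = 1%:M.
  by rewrite trmx_delta mul_delta_mx; apply/matrixP => i j; rewrite !ord1 !mxE.
have E0 : G10 *m P0 *m G20 = 1%:M - e *m e^T.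
  apply: mx_has_value_uniq Ev _; rewrite SE => i j.
  rewrite trmx_delta mul_delta_mx !mxE.
  have [<-|ij] /= := eqVneq i j; last first.
    rewrite mulr0n [_ && _](_ : _ = false) ?subr0; first exact: has_value0.
    by apply: contra_neqF ij => /andP[/eqP-> /eqP->].
  rewrite andbb mulr1n; have [->|ik] := eqVneq i k.
    by rewrite nuk subrr expr1z; apply: has_value_uniformizer.
  by rewrite nu0 // subr0 expr0z; apply: has_value1.
have Ee : G10 *m P0 *m G20 *m e = 0.
  by rewrite E0 mulmxBl mul1mx -mulmxA ee mulmx1 subrr.
have eE : e^T *m G10 *m P0 *m G20 = 0.
  by rewrite -!mulmxA [G10 *m _]mulmxA E0 mulmxBr mulmx1 mulmxA ee mul1mx subrr.
pose v := G20 *m e; pose w := G10^T *m e.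
have wT : w^T = e^T *m G10 by rewrite trmx_mul trmxK.
have wP : w^T *m P0 = 0 by rewrite wT -[LHS](mulmxK G2u) eE mul0mx.
exists v, w, (invmx G10 *m e), ((invmx G20)^T *m e); split.
- rewrite -[LHS](mulKmx G1u) [G10 *m _](_ : _ = 0) ?mulmx0 //.
  by rewrite !mulmxA.
- exact: wP.
- have [Q PE QE] := polymx_taylor P; rewrite -QE.
  pose t : ratf := ('X - z%:P)%:F; pose wF := const_ratmx w.
  pose eF : 'cV[ratf]_q := const_ratmx e.
  have PFE : PF = const_ratmx P0 + t *: poly_ratmx Q.
    by rewrite /PF {1}PE; apply/matrixP => i j; rewrite !mxE tofracD tofracM.
  have left_ : wF^T *m PF = t *: (wF^T *m poly_ratmx Q).
    rewrite PFE mulmxDr -scalemxAr.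
    have -> : wF^T *m const_ratmx P0 = const_ratmx (w^T *m P0).
      by rewrite const_ratmxM /wF /const_ratmx -poly_ratmx_tr map_trmx.
    rewrite wP [const_ratmx 0](_ : _ = 0) ?add0r //.
    by apply/matrixP => i j; rewrite !mxE polyC0 tofrac0.
  have right_ : PF *m (G2 *m eF) = t *: (invmx G1 *m eF).
    rewrite -[LHS](mulKmx (invertible_at_unit G1P)) scalemxAr.
    congr (_ *m _); rewrite !mulmxA SE; apply/matrixP => i j.
    rewrite mul_diag_mx !mxE; have [->|_] := eqVneq i k.
      by rewrite nuk expr1z.
    by rewrite polyC0 tofrac0 !mulr0.
  have mid : wF^T *m poly_ratmx Q *m (G2 *m eF) = wF^T *m (invmx G1 *m eF).
    apply: (scalerI (uniformizer_neq0 z)).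
    by rewrite scalemxAl -left_ -mulmxA right_ -scalemxAr.
  have wv := mx_has_value_tr (mx_has_value_const z w).
  have ev := mx_has_value_const z e.
  have midv := mx_has_valueM (mx_has_valueM wv (mx_has_value_poly z Q))
    (mx_has_valueM G2v ev).
  have G1V := mx_has_value_inv G1v G1u.
  move: midv; rewrite mid => /mx_has_value_uniq.
  move=> /(_ _ (mx_has_valueM wv (mx_has_valueM G1V ev))) ->.
  by rewrite wT !mulmxA mulmxK // ee !mxE.
- by rewrite /v trmx_mul trmxK -mulmxA (mulKmx G2u).
- rewrite trmx_mul trmxK [P0 + _](_ : _ = invmx G10 *m invmx G20).
    by rewrite unitmx_mul !unitmx_inv G1u.
  apply: (can_inj (mulKmx G1u)); apply: (can_inj (mulmxK G2u)).
  rewrite mulmxDr mulmxDl E0 !mulmxA mulmxV // mul1mx mulmxKV //.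
  by rewrite mulmxKV // subrK.
Qed.

End SimpleEigenvalue.

(** * Limits of matrices depending on a parameter *)

Section Limits.
Variables (K : numFieldType) (T : Type) (F : set_system T).
Context {FF : Filter F}.

Lemma cvg_horner (f : T -> K) (a : K) (p : {poly K}) :
  f e @[e --> F] --> a -> p.[f e] @[e --> F] --> p.[a].
Proof.
move=> fa; elim/poly_ind: p => [|p c IHp].
  by under eq_cvg do rewrite horner0; rewrite horner0; apply: cvg_cst.
under eq_cvg do rewrite hornerMXaddC; rewrite hornerMXaddC.
by apply: cvgD; [apply: cvgM|apply: cvg_cst].
Qed.

Lemma cvg_shift (d : T -> K) (a : K) :
  d e @[e --> F] --> (0 : K) -> a + d e @[e --> F] --> a.
Proof.
by move=> d0; rewrite -[X in _ --> X]addr0; apply: cvgD => //; apply: cvg_cst.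
Qed.

(** Convergence is taken entry by entry, so that polynomial expressions in the
    entries, such as determinants and adjugates, inherit it directly. *)
Definition mx_cvg m n (M : T -> 'M[K]_(m, n)) (M0 : 'M[K]_(m, n)) : Prop :=
  forall i j, M e i j @[e --> F] --> M0 i j.

Lemma mx_cvg_cst m n (M0 : 'M[K]_(m, n)) : mx_cvg (fun=> M0) M0.
Proof. by move=> i j; apply: cvg_cst. Qed.

Lemma mx_cvgD m n (M N : T -> 'M[K]_(m, n)) M0 N0 :
  mx_cvg M M0 -> mx_cvg N N0 -> mx_cvg (fun e => M e + N e) (M0 + N0).
Proof.
move=> MM0 NN0 i j; under eq_cvg do rewrite mxE; rewrite mxE.
exact: cvgD.
Qed.

Lemma mx_cvgN m n (M : T -> 'M[K]_(m, n)) M0 :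
  mx_cvg M M0 -> mx_cvg (fun e => - M e) (- M0).
Proof.
move=> MM0 i j; under eq_cvg do rewrite mxE; rewrite mxE.
exact: cvgN.
Qed.

Lemma mx_cvgZ m n (f : T -> K) (a : K) (M : T -> 'M[K]_(m, n)) M0 :
  f e @[e --> F] --> a -> mx_cvg M M0 -> mx_cvg (fun e => f e *: M e) (a *: M0).
Proof.
move=> fa MM0 i j; under eq_cvg do rewrite mxE; rewrite mxE.
exact: cvgM.
Qed.

Lemma mx_cvgM m n r (M : T -> 'M[K]_(m, n)) (N : T -> 'M[K]_(n, r)) M0 N0 :
  mx_cvg M M0 -> mx_cvg N N0 -> mx_cvg (fun e => M e *m N e) (M0 *m N0).
Proof.
move=> MM0 NN0 i j; under eq_cvg do rewrite mxE; rewrite mxE.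
apply: cvg_big => [|k _]; first exact: add_continuous.
exact: cvgM.
Qed.

Lemma cvg_det n (M : T -> 'M[K]_n) M0 :
  mx_cvg M M0 -> \det (M e) @[e --> F] --> \det M0.
Proof.
move=> MM0; apply: cvg_big => [|s _]; first exact: add_continuous.
apply: cvgM; first exact: cvg_cst.
by apply: cvg_big => [|k _]; first exact: mul_continuous.
Qed.

Lemma mx_cvg_adj n (M : T -> 'M[K]_n) M0 :
  mx_cvg M M0 -> mx_cvg (fun e => \adj (M e)) (\adj M0).
Proof.
move=> MM0 i j; under eq_cvg do rewrite mxE; rewrite mxE.
apply: cvgM; first exact: cvg_cst.
by apply: cvg_det => k l; under eq_cvg do rewrite 2!mxE; rewrite 2!mxE; apply: MM0.
Qed.

Lemma mx_cvg_horner m n (f : T -> K) (a : K) (P : 'M[{poly K}]_(m, n)) :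
  f e @[e --> F] --> a ->
  mx_cvg (fun e => horner_mx_at (f e) P) (horner_mx_at a P).
Proof.
move=> fa i j; under eq_cvg do rewrite mxE; rewrite mxE.
exact: cvg_horner.
Qed.

Lemma mx_cvg_perturb m n (f s : T -> K) (a : K) (P dP : 'M[{poly K}]_(m, n)) :
  f e @[e --> F] --> a -> s e @[e --> F] --> (0 : K) ->
  mx_cvg (fun e => horner_mx_at (f e) P + s e *: horner_mx_at (f e) dP)
         (horner_mx_at a P).
Proof.
move=> fa s0; rewrite -[horner_mx_at a P]addr0 -(scale0r (horner_mx_at a dP)).
apply: mx_cvgD; first exact: mx_cvg_horner.
by apply: mx_cvgZ => //; apply: mx_cvg_horner.
Qed.

Lemma near_unitmx n (M : T -> 'M[K]_n) M0 :
  mx_cvg M M0 -> M0 \in unitmx -> \forall e \near F, M e \in unitmx.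
Proof.
move=> /cvg_det Md; rewrite unitmxE unitfE => M0u.
apply: filterS (cvgr_neq0 _ Md M0u) => e.
by rewrite unitmxE unitfE.
Qed.

(** If [M0 *m L] is the identity, then [M e *m L] tends to it and is
    eventually invertible. *)
Lemma near_row_free m n (M : T -> 'M[K]_(m, n)) M0 :
  mx_cvg M M0 -> row_free M0 -> \forall e \near F, row_free (M e).
Proof.
move=> MM0 /row_freeP[L ML].
have Lc : mx_cvg (fun=> L) L by apply: mx_cvg_cst.
have := near_unitmx (mx_cvgM MM0 Lc); rewrite ML.
move=> /(_ (unitmx1 _ _)); apply: filterS => e ML_unit.
apply/row_freeP; exists (L *m invmx (M e *m L)).
by rewrite mulmxA mulmxV.
Qed.

Lemma mx_cvg_tr m n (M : T -> 'M[K]_(m, n)) M0 :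
  mx_cvg M M0 -> mx_cvg (fun e => (M e)^T) M0^T.
Proof. by move=> MM0 i j; under eq_cvg do rewrite mxE; rewrite mxE; apply: MM0. Qed.

Lemma mx_cvg_row m n1 n2 (M : T -> 'M[K]_(m, n1)) (N : T -> 'M[K]_(m, n2)) M0 N0 :
  mx_cvg M M0 -> mx_cvg N N0 ->
  mx_cvg (fun e => row_mx (M e) (N e)) (row_mx M0 N0).
Proof.
move=> MM0 NN0 i j; case: (split_ordP j) => k ->.
  by under eq_cvg do rewrite row_mxEl; rewrite row_mxEl; apply: MM0.
by under eq_cvg do rewrite row_mxEr; rewrite row_mxEr; apply: NN0.
Qed.

Lemma mx_cvg_col m1 m2 n (M : T -> 'M[K]_(m1, n)) (N : T -> 'M[K]_(m2, n)) M0 N0 :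
  mx_cvg M M0 -> mx_cvg N N0 ->
  mx_cvg (fun e => col_mx (M e) (N e)) (col_mx M0 N0).
Proof.
move=> MM0 NN0 i j; case: (split_ordP i) => k ->.
  by under eq_cvg do rewrite col_mxEu; rewrite col_mxEu; apply: MM0.
by under eq_cvg do rewrite col_mxEd; rewrite col_mxEd; apply: NN0.
Qed.

Lemma near_rank_col m n (M : T -> 'M[K]_(m, n)) M0 :
  mx_cvg M M0 -> \rank M0 = n -> \forall e \near F, \rank (M e) = n.
Proof.
move=> /mx_cvg_tr Mc M0n; have := near_row_free Mc.
rewrite -row_leq_rank mxrank_tr M0n => /(_ (leqnn n)).
by apply: filterS => e; rewrite -[row_free _]/(_ == _) mxrank_tr => /eqP.
Qed.

(** Bordering. Write [N e] for the perturbed singular matrix. The matrix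
    [N e + b c^T] is invertible near the limit, and the kernel of
    [N e] is spanned by [X e = adj (N e + b c^T) b], which depends
    polynomially on [d e] and [s e] and tends to a multiple of [v]. Since
    [w^T P(z) = 0], expanding [w^T (N e) (X e) = 0] with the exact
    quotient of [P - P(z)] leaves the asserted relation. *)
Lemma perturbation_relation q (P dP : 'M[{poly K}]_q) (z : K)
    (v w b c : 'cV[K]_q) (d s : T -> K) :
  let P0 := horner_mx_at z P in
  let pairing (M : 'M[{poly K}]_q) := (w^T *m horner_mx_at z M *m v) 0 0 in
  P0 *m v = 0 -> w^T *m P0 = 0 -> c^T *m v = 1%:M ->
  P0 + b *m c^T \in unitmx ->
  d e @[e --> F] --> (0 : K) -> s e @[e --> F] --> (0 : K) ->
  (\forall e \near F, exists2 x : 'cV[K]_q, x != 0 &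
     (horner_mx_at (z + d e) P + s e *: horner_mx_at (z + d e) dP) *m x = 0) ->
  exists (k : K) (alpha beta : T -> K),
    [/\ k != 0, alpha e @[e --> F] --> k * pairing (map_mx (@deriv K) P),
        beta e @[e --> F] --> k * pairing dP &
        \forall e \near F, d e * alpha e + s e * beta e = 0].
Proof.
move=> P0 pairing Pv wP cv Ku d0 s0 sing.
have zd : z + d e @[e --> F] --> z by apply: cvg_shift.
pose N e := horner_mx_at (z + d e) P + s e *: horner_mx_at (z + d e) dP.
pose Ke e := N e + b *m c^T.
have Kc : mx_cvg Ke (P0 + b *m c^T).
  by apply: mx_cvgD; [apply: mx_cvg_perturb|apply: mx_cvg_cst].
pose X e := \adj (Ke e) *m b.
have [Q PE QE] := polymx_taylor z P.
pose k := \det (P0 + b *m c^T).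
have Xc : mx_cvg X (k *: v).
  have -> : k *: v = \adj (P0 + b *m c^T) *m b.
    have bE : (P0 + b *m c^T) *m v = b by rewrite mulmxDl Pv add0r -mulmxA cv mulmx1.
    by rewrite -[X in \adj _ *m X]bE mulmxA mul_adj_mx mul_scalar_mx.
  by apply: mx_cvgM; [apply: mx_cvg_adj|apply: mx_cvg_cst].
have lim M : (w^T *m horner_mx_at (z + d e) M *m X e) 0 0 @[e --> F]
    --> k * pairing M.
  have -> : k * pairing M = (w^T *m horner_mx_at z M *m (k *: v)) 0 0.
    by rewrite -scalemxAr mxE.
  apply: (mx_cvgM _ Xc); apply: mx_cvgM; first exact: mx_cvg_cst.
  exact: mx_cvg_horner.
exists k, (fun e => (w^T *m horner_mx_at (z + d e) Q *m X e) 0 0),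
  (fun e => (w^T *m horner_mx_at (z + d e) dP *m X e) 0 0); split.
- by rewrite -unitfE -unitmxE.
- by have := lim Q; rewrite /pairing QE.
- exact: lim.
near=> e.
have [x x0 Nx] : exists2 x : 'cV[K]_q, x != 0 & N e *m x = 0 by near: e.
have Keu : Ke e \in unitmx by near: e; apply: near_unitmx Kc Ku.
have Kx : Ke e *m x = b *m (c^T *m x) by rewrite mulmxDl Nx add0r mulmxA.
(* [X e] is a multiple of [x]: both are mapped to multiples of [b]. *)
have NX : N e *m X e = 0.
  pose a := (c^T *m x) 0 0.
  have aE : c^T *m x = a%:M by apply: mx11_scalar.
  have XE : a *: X e = \det (Ke e) *: x.
    by rewrite -[RHS]mul_scalar_mx -mul_adj_mx -mulmxA Kx aE mul_mx_scalar
      -scalemxAr.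
  have a0 : a != 0.
    apply: contraNneq x0 => a0; rewrite -[x](mulKmx Keu) Kx aE a0.
    by rewrite raddf0 !mulmx0.
  by apply: (scalerI a0); rewrite scalemxAr XE -scalemxAr Nx !scaler0.
have : (w^T *m (N e *m X e)) 0 0 = 0 by rewrite NX mulmx0 mxE.
have -> : N e = P0 + d e *: horner_mx_at (z + d e) Q
    + s e *: horner_mx_at (z + d e) dP.
  congr (_ + _); apply/matrixP => i j; rewrite [in LHS]PE !mxE /horner_eval.
  by rewrite hornerD hornerM hornerC hornerXsubC [z + _]addrC addrK.
rewrite !mulmxDl !mulmxDr mulmxA wP mul0mx add0r -!scalemxAl -!scalemxAr !mulmxA.
by rewrite !mxE.
Unshelve. all: by end_near.
Qed.

End Limits.

(** * Limits of rational functions and root vectors *)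

Section RationalLimit.
Variable K : numFieldType.

Lemma has_value_cvg (z : K) f (a : K) :
  has_value z f a -> ratf_eval e f @[e --> z^'] --> a.
Proof.
move=> /has_valueP[p [q [qz -> ->]]].
have idc : (fun e : K => e) e @[e --> z^'] --> z by apply: nbhs_dnbhs.
have pq : p.[e] / q.[e] @[e --> z^'] --> p.[z] / q.[z].
  by apply: cvgM; [|apply: cvgV => //]; apply: cvg_horner.
apply: cvg_trans pq; apply: near_eq_cvg.
have qn : \forall e \near z^', q.[e] != 0.
  exact: (cvgr_neq0 _ (cvg_horner idc) qz).
near=> e; have qe : q.[e] != 0 by near: e.
by have [_ ->] := ratf_evalE p qe.
Unshelve. all: by end_near.
Qed.

Lemma right_root_vectorI q (z : K) (M : 'M[{fraction {poly K}}]_q) x x0 :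
  mx_has_value z x x0 -> x0 != 0 -> mx_has_value z (M *m x) 0 ->
  right_root_vector z M x.
Proof.
move=> /mx_has_valueP[zx xE] x00 Mx.
split; [exact: zx|by rewrite xE|move=> i].
by have := has_value_cvg (Mx i 0); rewrite [(0 : 'M[K]_(q, 1)) _ _]mxE; apply.
Qed.

Lemma left_root_vectorI q (z : K) (M : 'M[{fraction {poly K}}]_q) y y0 :
  mx_has_value z y y0 -> y0 != 0 -> mx_has_value z (M^T *m y) 0 ->
  left_root_vector z M y.
Proof.
move=> yv y00 My; have [zy y0' yM] := right_root_vectorI yv y00 My.
split; [exact: zy|exact: y0'|move=> j].
by have := yM j; rewrite -[M^T *m y]trmxK trmx_mul trmxK mxE; apply.
Qed.

End RationalLimit.

(** * Moduli of complex numbers and first-order asymptotics *)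

Section Complex.
Variable R : realType.
Local Notation K := (R[i] : numFieldType).

Lemma cvg_real_complex0 : e%:C @[e --> (0 : R)^'+] --> (0 : K).
Proof.
refine ((cvgr0Pnorm_lt (V := K) (real_complex R)).2 _) => -[a b].
rewrite ltcE /= => /andP[/eqP -> a0].
near=> e.
have e0 : 0 < e by near: e; apply: nbhs_right_gt.
rewrite normc_def /= expr0n /= addr0 sqrtr_sqr gtr0_norm // ltcR.
near: e; exact: nbhs_right_lt.
Unshelve. all: by end_near.
Qed.

Lemma cvg_normc T (F : set_system T) {FF : Filter F} (f : T -> K) (a : K) :
  f e @[e --> F] --> a -> normc (f e) @[e --> F] --> normc a.
Proof.
move=> fa; apply/cvgrPdist_lt => eps eps0.
have : \forall e \near F, `|a - f e| < (eps%:C : K).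
  by move/cvgrPdist_lt : fa; apply; rewrite ltcR.
have normE (x : K) : `|x| = (normc x)%:C by case: x.
apply: filterS => e; rewrite normE ltcR => H.
apply: le_lt_trans H.
have h1 : normc a <= normc (a - f e) + normc (f e).
  by have := le_normcD (a - f e) (f e); rewrite subrK.
have h2 : normc (f e) <= normc (a - f e) + normc a.
  have := le_normcD (f e - a) a; rewrite subrK.
  by rewrite -[f e - a]opprB normcN.
by rewrite ler_norml; apply/andP; split; lra.
Qed.

Lemma littleo_right0 (f g : R -> R) :
  (forall eps : R, 0 < eps ->
     \forall e \near (0 : R)^'+, `|f e - g e| <= eps * `|e|) ->
  forall e : R, f e = g e +o_(e \near (0 : R)^'+) e.
Proof.
move=> fg e.
exact: (congr1 (@^~ e) ((eqaddoP _ f g (fun e : R => e)).2 fg)).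
Qed.

Lemma normc_real (e : R) : 0 < e -> normc (e%:C : K) = e.
Proof. by move=> e0; rewrite /= expr0n addr0 sqrtr_sqr gtr0_norm. Qed.

Lemma quotient_asymptotics (d alpha beta : R -> K) (a b : K) :
  a != 0 -> alpha e @[e --> (0 : R)^'+] --> a ->
  beta e @[e --> (0 : R)^'+] --> b ->
  (\forall e \near (0 : R)^'+, d e * alpha e + e%:C * beta e = 0) ->
  forall e : R, normc (d e) = e * normc (b / a) +o_(e \near (0 : R)^'+) e.
Proof.
move=> a0 alpha_a beta_b rel.
apply: (littleo_right0 (f := fun e => normc (d e))
  (g := fun e => e * normc (b / a))).
move=> eps eps0; have alpha0 := cvgr_neq0 _ alpha_a a0.
have quo : beta e / alpha e @[e --> (0 : R)^'+] --> b / a.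
  exact: (cvgM beta_b (cvgV a0 alpha_a)).
have quoN : normc (beta e / alpha e) @[e --> (0 : R)^'+] --> normc (b / a).
  exact: cvg_normc quo.
have close := (cvgrPdist_le _ _).1 quoN eps eps0.
near=> e.
have e0 : 0 < e by near: e; apply: nbhs_right_gt.
have alphae : alpha e != 0 by near: e; exact: alpha0.
have -> : normc (d e) = e * normc (beta e / alpha e).
  have -> : d e = - (e%:C * (beta e / alpha e)).
    apply: (mulIf alphae); rewrite mulNr -mulrA divfK //.
    by apply/eqP; rewrite -addr_eq0; apply/eqP; near: e.
  by rewrite normcN ComplexField.Normc.normcM normc_real.
rewrite -mulrBr normrM mulrC ler_wpM2r // distrC.
by near: e; exact: close.
Unshelve. all: by end_near.
Qed.

End Complex.

(** * Persistence of regularity and minimality *)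

Lemma horner_mx_at_perturb (K : numFieldType) m n (z e : K)
    (M dM : 'M[{poly K}]_(m, n)) :
  horner_mx_at z (perturb e M dM) = horner_mx_at z M + e *: horner_mx_at z dM.
Proof.
by apply/matrixP => i j; rewrite !mxE /horner_eval hornerD hornerM hornerC.
Qed.

Lemma system_matrix_perturb (K : numFieldType) n p (e : K)
    (A dA : 'M[{poly K}]_n) (B dB : 'M[{poly K}]_(n, p))
    (C dC : 'M[{poly K}]_(p, n)) (D dD : 'M[{poly K}]_p) :
  system_matrix (perturb e A dA) (perturb e B dB) (perturb e C dC)
    (perturb e D dD) =
  perturb e (system_matrix A B C D) (system_matrix dA dB dC dD).
Proof.
by rewrite /perturb /system_matrix scale_block_mx add_block_mx opprD scalerN.
Qed.

Section NearPerturbation.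
Variables (K : numFieldType) (T : Type) (F : set_system T).
Context {FF : Filter F}.
Variable s : T -> K.

(** Evaluate the determinant at a point where the unperturbed one is nonzero;
    such a point exists since a polynomial has at most as many roots as its
    degree. *)
Lemma near_regular_perturb n (M dM : 'M[{poly K}]_n) :
  s e @[e --> F] --> (0 : K) -> regular M ->
  \forall e \near F, regular (perturb (s e) M dM).
Proof.
rewrite /regular => s0 M0.
have [x Mx] : exists x : K, (\det M).[x] != 0.
  apply: contra_neqP M0 => Mx; apply: contra_notP Mx => M0; move/eqP: M0 => M0.
  pose rs := [seq i%:R : K | i <- iota 0 (size (\det M))].
  have rsu : uniq rs.
    by rewrite map_inj_uniq ?iota_uniq // => i j /eqP; rewrite eqr_nat => /eqP.
  have [] := boolP (all (root (\det M)) rs) => [allr|/allPn[x _ ?]];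
    last by exists x.
  by have := max_poly_roots M0 allr rsu; rewrite size_map size_iota ltnn.
have detE (N : 'M[{poly K}]_n) : (\det N).[x] = \det (horner_mx_at x N).
  by rewrite -/(horner_eval x _) -det_map_mx.
have xc : (fun=> x) e @[e --> F] --> x by apply: cvg_cst.
have M0u : horner_mx_at x M \in unitmx by rewrite unitmxE unitfE -detE.
apply: filterS (near_unitmx (mx_cvg_perturb dM xc s0) M0u) => e.
rewrite -horner_mx_at_perturb unitmxE unitfE -detE.
by apply: contraNneq => ->; rewrite horner0.
Qed.

Lemma near_minimal_at n p (A dA : 'M[{poly K}]_n) (B dB : 'M[{poly K}]_(n, p))
    (C dC : 'M[{poly K}]_(p, n)) (z : T -> K) (z0 : K) :
  s e @[e --> F] --> (0 : K) -> z e @[e --> F] --> z0 ->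
  minimal_at z0 A B C ->
  \forall e \near F, minimal_at (z e) (perturb (s e) A dA)
    (perturb (s e) B dB) (perturb (s e) C dC).
Proof.
move=> s0 zz0 [rC rB].
have pc m r (M dM : 'M[{poly K}]_(m, r)) : mx_cvg F
    (fun e => horner_mx_at (z e) M + s e *: horner_mx_at (z e) dM)
    (horner_mx_at z0 M).
  exact: mx_cvg_perturb.
have nC : \forall e \near F, \rank (col_mx
    (- (horner_mx_at (z e) A + s e *: horner_mx_at (z e) dA))
    (horner_mx_at (z e) C + s e *: horner_mx_at (z e) dC)) = n.
  exact: near_rank_col (mx_cvg_col (mx_cvgN (pc _ _ A dA)) (pc _ _ C dC)) rC.
have nB : \forall e \near F, row_free (row_mx
    (horner_mx_at (z e) A + s e *: horner_mx_at (z e) dA)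
    (horner_mx_at (z e) B + s e *: horner_mx_at (z e) dB)).
  apply: near_row_free (mx_cvg_row (pc _ _ A dA) (pc _ _ B dB)) _.
  by rewrite /row_free rB.
near=> e; rewrite /minimal_at !horner_mx_at_perturb; split.
  by near: e; exact: nC.
by apply/eqP; near: e; exact: nB.
Unshelve. all: by end_near.
Qed.

End NearPerturbation.

(** * Displacement of a simple eigenvalue *)

Theorem corollary3p6 (R : realType) (n p : nat)
  (A dA : 'M[{poly R[i]}]_n) (B dB : 'M[{poly R[i]}]_(n, p))
  (C dC : 'M[{poly R[i]}]_(p, n)) (D dD : 'M[{poly R[i]}]_p)
  (lambda0 : R[i]) (v : 'cV[R[i]]_(n + p)) (dlambda : R -> R[i]) :
  let P := system_matrix A B C D in
  let dP := system_matrix dA dB dC dD in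
  let G := transfer_function A B C D in
  let dG := transfer_variation A dA B dB C dC dD in
  let Geps (e : R) := transfer_function (perturb e%:C A dA)
    (perturb e%:C B dB) (perturb e%:C C dC) (perturb e%:C D dD) in
  regular P -> regular A ->
  is_simple_eigenvalue lambda0 P -> right_eigenvector lambda0 P v ->
  minimal_at lambda0 A B C ->
  dlambda e @[e --> 0^'+] --> (0 : (R[i] : numFieldType)) ->
  (\forall e \near (0 : R)^'+, exists dv : 'cV[R[i]]_(n + p),
      v + e%:C *: dv != 0 /\
      (horner_mx_at (lambda0 + dlambda e) P
         + e%:C *: horner_mx_at (lambda0 + dlambda e) dP)
        *m (v + e%:C *: dv) = 0) ->
  (\forall e \near (0 : R)^'+,
      regular (perturb e%:C A dA) /\ is_zero (lambda0 + dlambda e) (Geps e)) /\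
  exists (x y : 'cV[{fraction {poly R[i]}}]_p) (l : R),
    [/\ right_root_vector lambda0 G x,
        left_root_vector lambda0 G y,
        (y^T *m ratmx_deriv G *m x) 0 0 != 0,
        normc (ratf_eval z ((y^T *m dG *m x) 0 0
                 / (y^T *m ratmx_deriv G *m x) 0 0))
          @[z --> (lambda0 : (R[i] : numFieldType))^'] --> l &
        forall e : R, normc (dlambda e)
          = e * l +o_(e \near (0 : R)^'+) e].
Proof.
move=> P dP G dG Geps Pr Ar simple _ mini d0 sing.
have s0 : e%:C @[e --> (0 : R)^'+] --> (0 : (R[i] : numFieldType)).
  exact: cvg_real_complex0.
have {}sing : \forall e \near (0 : R)^'+, exists2 x : 'cV[R[i]]_(n + p), x != 0 &
     (horner_mx_at (lambda0 + dlambda e) P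
       + e%:C *: horner_mx_at (lambda0 + dlambda e) dP) *m x = 0.
  by apply: filterS sing => e [dv [? ?]]; exists (v + e%:C *: dv).
split.
  have zc : lambda0 + dlambda e @[e --> (0 : R)^'+]
      --> (lambda0 : (R[i] : numFieldType)).
    exact: cvg_shift d0.
  have nA : \forall e \near (0 : R)^'+, regular (perturb e%:C A dA).
    exact: near_regular_perturb dA s0 Ar.
  have nP : \forall e \near (0 : R)^'+, regular (perturb e%:C P dP).
    exact: near_regular_perturb dP s0 Pr.
  have nM : \forall e \near (0 : R)^'+, minimal_at (lambda0 + dlambda e)
      (perturb e%:C A dA) (perturb e%:C B dB) (perturb e%:C C dC).
    exact (near_minimal_at dA dB dC s0 zc mini).
  near=> e.
  have eA : regular (perturb e%:C A dA) by near: e.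
  split=> //.
  have [u u0 Pu] : exists2 x : 'cV[R[i]]_(n + p), x != 0 &
     (horner_mx_at (lambda0 + dlambda e) P
       + e%:C *: horner_mx_at (lambda0 + dlambda e) dP) *m x = 0 by near: e.
  have eP : regular (perturb e%:C P dP) by near: e.
  have eM : minimal_at (lambda0 + dlambda e) (perturb e%:C A dA)
    (perturb e%:C B dB) (perturb e%:C C dC) by near: e.
  move: Pu; rewrite -horner_mx_at_perturb -system_matrix_perturb => Pu.
  have [X [x [_ _ xu u2 Gx]]] := root_vector_lift eA eM u0 Pu.
  apply: root_vector_zero xu u2 Gx; apply: regular_transfer => //.
  by rewrite system_matrix_perturb.
(* From here on [v0], [w0] are the normalised eigenvectors, with pairing 1. *)
have [v0 [w0 [b [c [Pv wP pair cv Ku]]]]] := simple_eigenvalue_data simple.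
have [k [alpha [beta [k0 alpha_lim beta_lim rel]]]] :=
  perturbation_relation Pv wP cv Ku d0 s0 sing.
have v00 : v0 != 0.
  by apply: contra_eq_neq pair => ->; rewrite mulmx0 mxE eq_sym oner_neq0.
have w00 : w0 != 0.
  by apply: contra_eq_neq pair => ->; rewrite trmx0 !mul0mx mxE eq_sym oner_neq0.
have [X [x [XE Xv xv x0 Gx]]] := root_vector_lift Ar mini v00 Pv.
have Atr : regular A^T by rewrite /regular det_tr.
have Pw : horner_mx_at lambda0 (system_matrix A^T C^T B^T D^T) *m w0 = 0.
  rewrite system_matrix_tr horner_mx_at_tr; apply: trmx_inj.
  by rewrite trmx_mul trmxK wP trmx0.
have [W [y [WE Wv yv y0 Gy]]] := root_vector_lift Atr (minimal_at_tr mini) w00 Pw.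
rewrite transfer_function_tr // in Gy.
have Uv : mx_has_value lambda0 (col_mx X x) v0.
  by rewrite -[v0]vsubmxK; apply: mx_has_value_col.
have Yv : mx_has_value lambda0 (col_mx W y) w0.
  by rewrite -[w0]vsubmxK; apply: mx_has_value_col.
have form_value M : has_value lambda0
    (((col_mx W y)^T *m poly_ratmx M *m col_mx X x) 0 0)
    ((w0^T *m horner_mx_at lambda0 M *m v0) 0 0).
  apply: mx_has_valueM Uv _ _; apply: mx_has_valueM (mx_has_value_poly _ _).
  exact: mx_has_value_tr.
have num_value : has_value lambda0 ((y^T *m dG *m x) 0 0)
    ((w0^T *m horner_mx_at lambda0 dP *m v0) 0 0).
  by rewrite (transfer_variation_form _ _ _ _ Ar XE WE).
have den_value : has_value lambda0 ((y^T *m ratmx_deriv G *m x) 0 0) 1.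
  rewrite ratmx_deriv_transfer // (transfer_variation_form _ _ _ _ Ar XE WE) -pair.
  have -> : system_matrix (map_mx (@deriv _) A) (map_mx (@deriv _) B)
    (map_mx (@deriv _) C) (map_mx (@deriv _) D) = map_mx (@deriv _) P.
    by rewrite /P /system_matrix map_block_mx map_mxN.
  exact: form_value.
exists x, y, (normc ((w0^T *m horner_mx_at lambda0 dP *m v0) 0 0)); split.
- exact: right_root_vectorI xv x0 Gx.
- exact: left_root_vectorI yv y0 Gy.
- apply/eqP => den0; rewrite den0 in den_value.
  have := has_value_uniq (has_value0 lambda0) den_value.
  by move/eqP; rewrite eq_sym oner_eq0.
- apply: cvg_normc; rewrite -[X in _ --> X]divr1.
  exact: has_value_cvg (has_value_div (oner_neq0 _) num_value den_value).
- rewrite pair mulr1 in alpha_lim.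
  have := quotient_asymptotics k0 alpha_lim beta_lim rel.
  by rewrite [k * _]mulrC (mulfK k0); apply.
Unshelve. all: by end_near.
Qed.
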